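(* Let $n\ge 2$, $r\ge 1$, and let $f\in E^r(\mathbb{T}^n)$ be a volume expanding map such that $\{w\in f^{-k}(x): k\in\mathbb{N}\}$ is dense in $\mathbb{T}^n$ for every $x\in\mathbb{T}^n$, and satisfying the following properties: (1) There is an open set $U_0$ in $\mathbb{T}^n$ such that $f|_{U_0^c}$ is expanding and $\mathrm{diam}(U_0)<1$. (2) There exist $0<\delta_0<\mathrm{diam}_{int}(U_0^c)$ and an open neighborhood $U_1$ of $\overline{U}_0$ such that for every arc $\gamma$ in $U_0^c$ with diameter larger than $\delta_0$ there is a point $y\in\gamma$ such that $f^k(y)\in U_1^c$ for every $k\ge 1$. (3) Moreover, for every $z\in U_1^c$ there exists $\bar z\in U_1^c$ such that $f(\bar z)=z$. Then for every $g$ sufficiently $C^r$-close to $f$ (i.e. for all $g$ in some neighborhood of $f$ in $E^r(\mathbb{T}^n)$), the set $\{w\in g^{-k}(x): k\in\mathbb{N}\}$ is dense in $\mathbb{T}^n$ for every $x\in\mathbb{T}^n$. In particular, $f$ is $C^r$-robustly transitive.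
   Context: $E^r(\mathbb{T}^n)$ is the space of $C^r$ maps (endomorphisms) $f:\mathbb{T}^n\to\mathbb{T}^n$ with the $C^r$ topology; $\mathbb{T}^n=\mathbb{R}^n/\mathbb{Z}^n$; $A^c$ denotes the complement of $A$ in $\mathbb{T}^n$. $f\in E^1(\mathbb{T}^n)$ is volume expanding if there exists $\sigma>1$ with $|\det(Df)|>\sigma$ everywhere. For a linear isomorphism $L$ of normed spaces, $m\{L\}=\|L^{-1}\|^{-1}$. $f$ is expanding in a subset $A$ if there exists $\lambda>1$ such that $\min_{x\in A} m\{D_xf\}>\lambda$. For subsets $A,B\subset\mathbb{R}^n$, $\mathrm{dist}(A,B)=\inf\{\max_{1\le i\le n}|x_i-y_i|: x\in A,\ y\in B\}$. For an open set $U\subset\mathbb{T}^n$, $\widetilde U$ denotes the lift of $U$ restricted to a fundamental domain of $\mathbb{R}^n$; $\mathrm{diam}(U)=\max\{\mathrm{dist}(x,y): x,y\in\widetilde U\}$ and $\mathrm{diam}_{int}(U^c)=\min_{k\in\mathbb{Z}^n\setminus\{0\}}\mathrm{dist}(\widetilde U,\widetilde U+k)$. When $\mathrm{diam}(U)<1$, the frame $\mathbb{Z}^n$ is translated so that $\widetilde U$ (and its closure) is contained in the interior of the fundamental domain $[0,1]^n$; in particular $\mathrm{diam}_{int}(U^c)>0$. The diameter of an arc in $\mathbb{T}^n$ is the diameter (with respect to $\mathrm{dist}$) of a connected lift of it to $\mathbb{R}^n$. A map $g$ is topologically transitive if some point $x$ has dense forward orbit $\{g^k(x)\}_{k\ge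 0}$. $f$ is $C^r$-robustly transitive if there is a $C^r$ neighborhood $\mathcal{U}(f)$ such that every $g\in\mathcal{U}(f)$ is transitive. *)

(* Defs.v *)
(* MathComp-Analysis; R^n is the space 'rV[R]_n of row vectors, whose library
   norm is the maximum norm. *)
From HB Require Import structures.
From mathcomp Require Import all_boot all_order all_algebra.
From mathcomp Require Import all_classical all_reals all_analysis.
Import Order.TTheory GRing.Theory Num.Theory numFieldNormedType.Exports.

Set Implicit Arguments.
Unset Strict Implicit.
Unset Printing Implicit Defensive.

Local Open Scope classical_set_scope.
Local Open Scope ring_scope.

Section Torus.
Context (R : realType) (n : nat).

Definition congr_lattice (x y : 'rV[R]_n) : bool :=
  x - y \is a mxOver Num.int.

Lemma congr_lattice_refl : reflexive congr_lattice.
Proof. by move=> x; apply/mxOverP => i j; rewrite subrr mxE rpred0. Qed.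

Lemma congr_lattice_sym : symmetric congr_lattice.
Proof.
move=> x y; apply/mxOverP/mxOverP => xy i j; rewrite -opprB mxE rpredN;
  exact: xy.
Qed.

Lemma congr_lattice_trans : transitive congr_lattice.
Proof.
move=> y x z /mxOverP xy /mxOverP yz; apply/mxOverP => i j.
by rewrite -(subrK y x) -addrA mxE rpredD.
Qed.

Canonical congr_lattice_equiv := EquivRel congr_lattice
  congr_lattice_refl congr_lattice_sym congr_lattice_trans.

Definition torus : Type :=
  quotient_topology {eq_quot congr_lattice_equiv}%qT.

HB.instance Definition _ := Topological.on torus.
HB.instance Definition _ := Quotient.on torus.

Definition torus_proj (x : 'rV[R]_n) : torus := (\pi_torus x)%qT.

Lemma torus_projP (x y : 'rV[R]_n) :
  reflect (torus_proj x = torus_proj y) (congr_lattice x y).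
Proof.
exact: (@eqquotP _ congr_lattice_equiv {eq_quot congr_lattice_equiv}%qT).
Qed.

(* The ball of radius e around p for the distance induced on the quotient. *)
Definition torus_ball (p : torus) (e : R) (q : torus) : Prop :=
  exists x y : 'rV[R]_n, [/\ torus_proj x = p, torus_proj y = q & `|x - y| < e].

Lemma torus_proj_surj (p : torus) : exists x, torus_proj x = p.
Proof. by exists (repr p); rewrite /torus_proj reprK. Qed.

Lemma torus_ball_center p (e : R) : 0 < e -> torus_ball p e p.
Proof.
move=> e0; have [x xp] := torus_proj_surj p.
by exists x, x; rewrite subrr normr0.
Qed.

Lemma torus_ball_sym p q (e : R) : torus_ball p e q -> torus_ball q e p.
Proof. by move=> [x [y [? ? ?]]]; exists y, x; rewrite distrC. Qed.

Lemma torus_ball_triangle p q s (e1 e2 : R) :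
  torus_ball p e1 q -> torus_ball q e2 s -> torus_ball p (e1 + e2) s.
Proof.
move=> [x [y [xp yq xy]]] [y' [z [yq' zs yz]]].
exists x, (z + (y - y')); split => //.
  rewrite -zs; apply/torus_projP.
  have -> : congr_lattice (z + (y - y')) z = congr_lattice y y'.
    by rewrite /congr_lattice addrAC subrr add0r.
  by apply/torus_projP; rewrite yq yq'.
have -> : x - (z + (y - y')) = (x - y) + (y' - z).
  rewrite opprD opprB addrCA -addrA [- z + _]addrC !addrA addrAC.
  by rewrite [_ + y']addrC.
exact: le_lt_trans (ler_normD _ _) (ltrD xy yz).
Qed.

End Torus.

Section Endomorphisms.
Context (R : realType) (n : nat).
Implicit Types F : 'rV[R]_n -> 'rV[R]_n.

Fixpoint Cr (r : nat) F : Prop :=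
  if r is k.+1 then
    (forall x, differentiable F x) /\
    (forall i : 'I_n, Cr k ('D_(delta_mx 0 i) F))
  else continuous F.

Definition partials (s : seq 'I_n) F : 'rV[R]_n -> 'rV[R]_n :=
  foldr (fun i G => 'D_(delta_mx 0 i) G) F s.

Definition Cr_lift (r : nat) (f : torus R n -> torus R n) F : Prop :=
  Cr r F /\ (forall x, torus_proj (F x) = f (torus_proj x)).

(* Every continuous self-map of the torus lifts to R^n, and it is of class C^r
   if and only if its lifts are. *)
Record endo (r : nat) := Endo {
  endo_fun :> torus R n -> torus R n ;
  endo_lift : exists F, Cr_lift r endo_fun F }.

HB.instance Definition _ r := gen_eqMixin (endo r).
HB.instance Definition _ r := gen_choiceMixin (endo r).

(* Two lifts of f differ by a constant integer vector, so the derivatives of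
   [lift_of f] depend only on f and are Z^n-periodic. *)
Definition lift_of r (f : endo r) : 'rV[R]_n -> 'rV[R]_n :=
  projT1 (cid (endo_lift f)).

Lemma lift_ofP r (f : endo r) : Cr_lift r f (lift_of f).
Proof. exact: projT2 (cid (endo_lift f)). Qed.

(* [jacobian] acts on row vectors from the right: D_p f v = v *m tangent f p. *)
Definition tangent r (f : endo r) (p : torus R n) : 'M[R]_n :=
  jacobian (lift_of f) (repr p).

(* Uniform closeness of the maps and of all partial derivatives of order
   between 1 and r; these balls define the C^r topology. *)
Definition Cr_ball r (f : endo r) (e : R) (g : endo r) : Prop :=
  (forall p, torus_ball (f p) e (g p)) /\
  (forall s : seq 'I_n, (0 < size s <= r)%N ->
    forall x, `|partials s (lift_of f) x - partials s (lift_of g) x| < e).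

Lemma Cr_ball_center r (f : endo r) (e : R) : 0 < e -> Cr_ball f e f.
Proof.
move=> e0; split=> [p|s _ x]; first exact: torus_ball_center.
by rewrite subrr normr0.
Qed.

Lemma Cr_ball_sym r (f g : endo r) (e : R) : Cr_ball f e g -> Cr_ball g e f.
Proof.
move=> [fg0 fg]; split=> [p|s rs x]; first exact: torus_ball_sym.
by rewrite distrC; exact: fg.
Qed.

Lemma Cr_ball_triangle r (f g h : endo r) (e1 e2 : R) :
  Cr_ball f e1 g -> Cr_ball g e2 h -> Cr_ball f (e1 + e2) h.
Proof.
move=> [fg0 fg] [gh0 gh]; split=> [p|s rs x].
  exact: torus_ball_triangle (fg0 p) (gh0 p).
apply: le_lt_trans (ler_distD (partials s (lift_of g) x) _ _) _.
by apply: ltrD; [exact: fg|exact: gh].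
Qed.

HB.instance Definition _ r := hasNbhs.Build (endo r)
  (nbhs_ (entourage_ (@Cr_ball r))).
HB.instance Definition _ r := Nbhs_isPseudoMetric.Build R (endo r)
  erefl (@Cr_ball_center r) (@Cr_ball_sym r) (@Cr_ball_triangle r) erefl.

End Endomorphisms.

Section Dynamics.
Context (R : realType) (n r : nat).
Implicit Types (f g : endo R n r) (A U : set (torus R n)).

Definition volume_expanding f : Prop :=
  exists2 sigma : R, 1 < sigma & forall p, sigma < `|\det (tangent f p)|.

Definition is_norm (N : 'rV[R]_n -> R) : Prop :=
  [/\ forall v w, N (v + w) <= N v + N w,
      forall (a : R) v, N (a *: v) = `|a| * N v
    & forall v, N v = 0 -> v = 0].

Definition opnorm (N : 'rV[R]_n -> R) (M : 'M[R]_n) : R :=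
  sup [set N (v *m M) | v in [set v | N v <= 1]].

(* m{L} = |L^-1|^-1 for an invertible L. *)
Definition conorm (N : 'rV[R]_n -> R) (M : 'M[R]_n) : R :=
  (opnorm N (invmx M))^-1.

Definition expanding_in (N : 'rV[R]_n -> R) f A : Prop :=
  exists2 lambda : R, 1 < lambda &
    forall p, A p -> tangent f p \in unitmx /\ lambda < conorm N (tangent f p).

Definition preorbit f (x : torus R n) : set (torus R n) :=
  [set w | exists k, iter k f w = x].

Definition topologically_transitive f : Prop :=
  exists x, dense [set iter k f x | k in [set: nat]].

Definition robustly_transitive f : Prop :=
  \forall g \near f, topologically_transitive g.

End Dynamics.

Section Diameters.
Context (R : realType) (n : nat).
Implicit Types (U : set (torus R n)) (a : 'rV[R]_n) (S T : set 'rV[R]_n).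

(* Distances and diameters are extended reals: the distance to the empty set
   is +oo. *)
Definition set_dist S T : \bar R :=
  ereal_inf [set (`|x - y|)%:E | x in S & y in T].

Definition diam S : \bar R :=
  ereal_sup [set (`|x - y|)%:E | x in S & y in S].

(* The fundamental domain [0,1]^n after translating the frame Z^n by a. *)
Definition cube a : set 'rV[R]_n :=
  [set x | forall i, a 0 i <= x 0 i <= a 0 i + 1].

Definition lift_in a U : set 'rV[R]_n := torus_proj (n:=n) @^-1` U `&` cube a.

Definition adapted_frame a U : Prop := closure (lift_in a U) `<=` (cube a)°.

(* diam_int of the complement of U. *)
Definition diam_int_compl a U : \bar R :=
  ereal_inf [set set_dist (lift_in a U) [set x + k | x in lift_in a U]
            | k in [set k | k \is a mxOver Num.int /\ k != 0]].

Definition arc_trace (T : Type) (c : R -> T) : set T := c @` `[0, 1].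

Definition torus_arc (gamma : R -> torus R n) : Prop :=
  {within `[0, 1], continuous gamma} /\ {in `[0, 1] &, injective gamma}.

Definition arc_lift (gamma : R -> torus R n) (c : R -> 'rV[R]_n) : Prop :=
  {within `[0, 1], continuous c} /\
  {in `[0, 1], forall t, torus_proj (c t) = gamma t}.

End Diameters.

(* Main.v *)
Require Import Defs.
From HB Require Import structures.
From mathcomp Require Import all_boot all_order fingroup perm all_algebra.
From mathcomp Require Import all_classical all_reals all_analysis.
From mathcomp Require Import ring lra zify.
Import Order.TTheory GRing.Theory Num.Theory numFieldNormedType.Exports.

(** Hypothesis (2) concerns [f] alone, bounds no times, and speaks of injective arcs of the torus.
    The approximate conjugacy need not be injective, so its image of the stretch is only a path: it
    is sampled finely, joined by segments, made injective by cutting, and shortened to a diameter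
    below 1, so that its projection to the torus is injective as well. The shortening needs
    [delta0 < 1], which holds when [U0] is nonempty. The arc follows the image up to an error [eps]
    that [F] may amplify at every step, so only orbit segments of a length [m] fixed beforehand are
    transferred to [G]. The order of choices is therefore: [kappa] and the final radius from [F];
    then [K] from [G] and the ball; then [m]; then [eps]. Volume is measured by Jordan outer
    content: only an upper estimate for preimages is needed, and finite covers by boxes give it
    directly, with no change of variables in an integral. *)

(* Let F be a lift of f to R^n; the lifts of the maps near f are, up to an integer
   vector, the maps G = F + phi with phi small and of small Lipschitz constant.
   Being a volume expanding homeomorphism of R^n, G maps any ball B to sets
   of exponentially growing volume, so some iterate of B contains a long path.
   This path has a stretch that stays away from the lifts of U0 and has diameter
   larger than delta0: the lifts of U0 are more than delta0 apart and have
   diameter less than 1.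
   Pulling back by F along the G-orbits, with a cutoff near U0, defines a
   continuous map close to the identity that semiconjugates G to F as long as the
   G-orbit stays in the expanding region. Hypothesis (2) for f, applied to an arc
   close to the image of the stretch, gives a point whose F-orbit avoids U0, hence
   a point of the stretch whose G-orbit stays, for as long as wanted, where G is
   expanding. A small ball around this point inside the iterate of B is therefore
   expanded to a ball of radius eps0, which depends on f only.
   By compactness, the preorbits of every g near f are eps0-dense, so every preorbit
   meets B. Transitivity follows by a Baire argument. *)

Set Implicit Arguments.
Unset Strict Implicit.
Unset Printing Implicit Defensive.

Local Open Scope classical_set_scope.
Local Open Scope ring_scope.

(** * Local inverses and global injectivity *)

Section RowVectors.
Context (R : realType) (n : nat).
Implicit Types (x y z v w : 'rV[R]_n) (e s rho : R).

Lemma coord_le_norm v i : `|v 0 i| <= `|v|.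
Proof.
rewrite [leRHS]/Num.Def.normr /= mx_normrE; apply/bigmax_geP; right => /=.
by exists (0, i).
Qed.

Lemma rV_norm_le v e : 0 <= e -> (forall i, `|v 0 i| <= e) -> `|v| <= e.
Proof.
move=> e0 ve; rewrite [leLHS]/Num.Def.normr /= mx_normrE.
by apply/bigmax_leP; split => //= -[i j] _; rewrite (ord1 i).
Qed.

Lemma continuous_dist (G : 'rV[R]_n -> 'rV[R]_n) w :
  continuous G -> continuous (fun y => `|w - G y|).
Proof.
move=> cG y; apply: continuous_comp; last exact: norm_continuous.
by apply: continuousB; [exact: cst_continuous|exact: cG].
Qed.

Lemma compact_cball x s : compact [set y | `|y - x| <= s].
Proof.
apply: bounded_closed_compact.
  exists (s + `|x|); split; first by rewrite num_real.
  move=> M sM y /= yx; rewrite -(subrK x y) (le_trans (ler_normD _ _))//.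
  by rewrite (le_trans _ (ltW sM))// lerD2r.
apply: (@preimage_closed _ _ (fun y => `|y - x|) [set t : R | t <= s]).
  move=> y _; rewrite (_ : (fun _ => _) = fun y => `|x - y|).
    by apply: continuous_dist => z; exact: cvg_id.
  by apply/funext => z; rewrite distrC.
exact: closed_le.
Qed.

(* Strict differentiability at scale [rho]. For small [k] this is also satisfied,
   with the same [L], by every perturbation of [G] whose difference with [G] is
   [k]-Lipschitz; the derivatives of the perturbed maps are never needed. *)
Definition strict_approx (G : 'rV[R]_n -> 'rV[R]_n) (L : 'rV[R]_n -> 'M[R]_n)
    e rho :=
  forall x y y', `|y - x| <= rho -> `|y' - x| <= rho ->
    `|G y - G y' - (y - y') *m L x| <= e * `|y - y'|.

Section LocalInverse.
Context (G : 'rV[R]_n -> 'rV[R]_n) (L : 'rV[R]_n -> 'M[R]_n) (c0 e rho : R).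
Hypotheses (cG : continuous G) (c0_gt0 : 0 < c0) (ec0 : e <= c0 / 4).
Hypotheses (GL : strict_approx G L e rho) (Lunit : forall x, L x \in unitmx).
Hypothesis Lge : forall x v, c0 * `|v| <= `|v *m L x|.

Lemma local_expansion x y y' : `|y - x| <= rho -> `|y' - x| <= rho ->
  c0 * (3 / 4) * `|y - y'| <= `|G y - G y'|.
Proof.
move=> yx y'x; have := GL yx y'x; have := Lge x (y - y').
have : e * `|y - y'| <= c0 / 4 * `|y - y'| by rewrite ler_wpM2r.
have := ler_distD (G y - G y') ((y - y') *m L x) 0.
rewrite !subr0 distrC => h1 h2 h3 h4.
have -> : c0 * (3 / 4) * `|y - y'| = c0 * `|y - y'| - c0 / 4 * `|y - y'|.
  by field.
lra.
Qed.

(** Minimise the residual [|w - G y|] over the closed ball. The minimiser is within [2 * s / 3] of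
    [x]; if its residual [z] were nonzero, a Newton step [u], of norm at most [s / 4], would stay in
    the ball and leave a residual of at most a quarter of [|z|]. *)
Lemma local_surjection x w s : 0 <= s -> s <= rho ->
  `|w - G x| <= c0 / 4 * s -> exists2 y, `|y - x| <= s & G y = w.
Proof.
move=> s0 srho wx.
pose A := [set y | `|y - x| <= s].
have Ax : A x by rewrite /A /= subrr normr0.
have [||y] := @EVT_min_rV R n (fun y => `|w - G y|) A _ (@compact_cball x s).
- by exists x.
- exact/continuous_subspaceT/continuous_dist.
rewrite inE => Ay ymin; exists y => //; apply/eqP; rewrite eq_sym -subr_eq0.
rewrite -normr_eq0 eq_le normr_ge0 andbT leNgt; apply/negP => z0.
set z := w - G y in z0.
have zs : `|z| <= c0 / 4 * s by apply: le_trans wx; apply: ymin; rewrite inE.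
have xrho : `|x - x| <= rho by rewrite subrr normr0 (le_trans s0).
have yrho : `|y - x| <= rho by rewrite (le_trans _ srho).
have yx : c0 * (3 / 4) * `|y - x| <= c0 / 2 * s.
  apply: le_trans (local_expansion yrho xrho) _.
  have -> : G y - G x = (w - G x) - z.
    by rewrite /z; apply/rowP => i; rewrite !mxE; ring.
  by apply: le_trans (ler_normB _ _) _; lra.
pose u := z *m invmx (L x).
have uL : u *m L x = z by rewrite /u mulmxKV.
have uz : c0 * `|u| <= `|z| by rewrite -uL; exact: Lge.
have {}yx : 3 * `|y - x| <= 2 * s.
  by rewrite -(ler_pM2l c0_gt0); lra.
have us : 4 * `|u| <= s by rewrite -(ler_pM2l c0_gt0); lra.
have y1s : `|y + u - x| <= s.
  by rewrite addrAC (le_trans (ler_normD _ _))//; lra.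
have := ymin (y + u); rewrite inE => /(_ y1s).
have := GL (le_trans y1s srho) yrho.
rewrite [y + u]addrC addrK uL => h1; rewrite leNgt => /negP; apply.
have -> : w - G (u + y) = - (G (u + y) - G y - z).
  by rewrite /z; apply/rowP => i; rewrite !mxE; ring.
rewrite normrN; apply: le_lt_trans h1 _.
apply: (@le_lt_trans _ _ (c0 / 4 * `|u|)); first by rewrite ler_wpM2r.
rewrite -/z; lra.
Qed.

Context (C : R).
Hypotheses (rho_gt0 : 0 < rho) (e_ge0 : 0 <= e) (C_ge0 : 0 <= C).
Hypothesis Lle : forall x v, `|v *m L x| <= C * `|v|.

Lemma local_lipschitz x y y' : `|y - x| <= rho -> `|y' - x| <= rho ->
  `|G y - G y'| <= (C + e) * `|y - y'|.
Proof.
move=> yx y'x; have := GL yx y'x; have := Lle x (y - y').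
have := ler_distD ((y - y') *m L x) (G y - G y') 0; rewrite !subr0; lra.
Qed.

Lemma local_injectivity x y : `|y - x| <= rho -> G x = G y -> x = y.
Proof.
move=> yx Gxy; apply/esym/eqP; rewrite -subr_eq0 -normr_le0.
have xx : `|x - x| <= rho by rewrite subrr normr0 ltW.
have := local_expansion yx xx; rewrite Gxy subrr normr0.
by rewrite pmulr_rle0// mulr_gt0// divr_gt0.
Qed.

(* A chain from [x] to [y] along which [G] takes values near [w = G x = G y]
   is deformed, by successive local inversions, to one on which [G] equals [w]:
   the endpoints do not move and the steps stay small. *)
Lemma global_injectivity : injective G.
Proof.
move=> x y Gxy; set w := G x; set d := `|y - x|.
have rho0 : 0 < rho by [].
have Ce0 : 0 <= C + e by rewrite addr_ge0.
have d0 : 0 <= d by exact: normr_ge0.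
(* The steps of the straight chain are to be at most [rho / 4], and their images at most
   [c0 * (3 / 16) * rho]. The latter is [c0 * (3 / 4)] times [rho / 4], so that [local_expansion]
   returns steps of at most [rho / 4]. It also makes each of the [3 * N] stages move a value by at
   most [c0 / 4 * (rho / 4)], the reach of [local_surjection]. *)
pose N := (Num.truncn (4 * d / rho + 16 / 3 * (C + e) * d / (c0 * rho))).+1.
have N0 : 0 < N%:R :> R by rewrite ltr0n.
have c0rho : 0 < c0 * rho by rewrite mulr_gt0.
have [N1 N2] : 4 * d <= N%:R * rho /\ (C + e) * d <= N%:R * (c0 * (3 / 16) * rho).
  have NE : 4 * d / rho + 16 / 3 * (C + e) * d / (c0 * rho) <= N%:R.
    by rewrite ltW// truncnS_gt.
  have p1 : 0 <= 4 * d / rho by apply: divr_ge0; [exact: mulr_ge0|exact: ltW].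
  have p2 : 0 <= 16 / 3 * (C + e) * d / (c0 * rho).
    by apply: divr_ge0; [rewrite !mulr_ge0//|exact: ltW].
  split; first by rewrite -ler_pdivrMr//; lra.
  have : 16 / 3 * (C + e) * d <= N%:R * (c0 * rho).
    by rewrite -ler_pdivrMr//; lra.
  lra.
pose z0 i : 'rV[R]_n := x + (i%:R / N%:R) *: (y - x).
have z0E i : z0 i.+1 - z0 i = N%:R^-1 *: (y - x).
  rewrite /z0 opprD addrACA subrr add0r -scalerBl -mulrBl -natr1.
  by rewrite [_ + 1 - _]addrAC subrr add0r mul1r.
have z0step i : `|z0 i - z0 i.+1| = d / N%:R.
  by rewrite distrC z0E normrZ gtr0_norm ?invr_gt0// mulrC.
have z0small i : `|z0 i - z0 i.+1| <= rho / 4.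
  by rewrite z0step ler_pdivrMr//; lra.
have Gz0step i : `|G (z0 i) - G (z0 i.+1)| <= c0 * (3 / 16) * rho.
  have s0 : `|z0 i - z0 i| <= rho by rewrite subrr normr0 ltW.
  have s1 : `|z0 i.+1 - z0 i| <= rho.
    by rewrite distrC (le_trans (z0small i))//; lra.
  rewrite (le_trans (local_lipschitz s0 s1))//.
  by rewrite z0step mulrA ler_pdivrMr//; lra.
have z00 : z0 0 = x by rewrite /z0 mul0r scale0r addr0.
have z0N : z0 N = y by rewrite /z0 divff ?gt_eqF// scale1r addrC subrK.
have Gz0w i : (i <= N)%N -> `|G (z0 i) - w| <= N%:R * (c0 * (3 / 16) * rho).
  have /(_ i) : forall i, `|G (z0 i) - w| <= i%:R * (c0 * (3 / 16) * rho).
    elim=> [|j IH]; first by rewrite z00 subrr normr0 mul0r.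
    have := ler_distD (G (z0 j)) (G (z0 j.+1)) w.
    rewrite [`|_ - G (z0 j)|]distrC.
    by have := Gz0step j; rewrite -natr1; lra.
  move=> h iN; apply: le_trans h _; rewrite ler_wpM2r ?ler_nat//.
  by rewrite mulr_ge0 ?ltW// mulr_gt0.
pose tau j : R := 1 - j%:R / (3 * N)%:R.
have tauS j : tau j.+1 = tau j - (3 * N)%:R^-1.
  by rewrite /tau -natr1 mulrDl mul1r opprD addrA.
have deform j : (j <= 3 * N)%N -> exists z : nat -> 'rV[R]_n,
    [/\ z 0 = x, z N = y, forall i, (i < N)%N -> `|z i - z i.+1| <= rho / 4
      & forall i, (i <= N)%N -> G (z i) = w + tau j *: (G (z0 i) - w)].
  elim: j => [_|j IH jN].
    exists z0; split=> // i iN; rewrite /tau mul0r subr0 scale1r.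
    by rewrite addrC subrK.
  have [z [zx zy zs Gz]] := IH (ltnW jN).
  have /choice[z' z'P] : forall i, exists y', (i <= N)%N ->
      `|y' - z i| <= rho / 4 /\ G y' = w + tau j.+1 *: (G (z0 i) - w).
    move=> i; case: (leqP i N) => [iN|]; last by exists 0.
    have [||| y' y'1 y'2] :=
      @local_surjection (z i) (w + tau j.+1 *: (G (z0 i) - w)) (rho / 4).
    - by rewrite divr_ge0// ltW.
    - lra.
    - rewrite Gz// tauS opprD addrACA subrr add0r -scalerBl.
      rewrite [_ - _ - _]addrAC subrr add0r normrZ normrN normfV.
      rewrite normr_nat mulrC ler_pdivrMr; last by rewrite ltr0n muln_gt0.
      by rewrite natrM; have := Gz0w i iN; lra.
    by exists y'.
  have fixed i : (i <= N)%N -> G (z i) = w -> z0 i = x \/ z0 i = y -> z' i = z i.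
    move=> iN Gzi zi; have [h1 h2] := z'P i iN; apply/esym/local_injectivity.
      by rewrite (le_trans h1)//; lra.
    rewrite Gzi h2; suff -> : G (z0 i) = w by rewrite subrr scaler0 addr0.
    by case: zi => ->.
  have z'x : z' 0%N = x by rewrite -[RHS]zx; apply: fixed => //; [rewrite zx|left].
  have z'y : z' N = y by rewrite -[RHS]zy; apply: fixed => //; [rewrite zy|right].
  exists z'; split=> // i iN; last by have [] := z'P i iN.
  have [a1 a2] := z'P i (ltnW iN); have [b1 b2] := z'P i.+1 iN.
  have zi := zs i iN.
  (* A stage stretches a step to at most [3 / 4 * rho]; being within [rho], it is brought back to
     [rho / 4] by [local_expansion]. *)
  have s1 : `|z' i.+1 - z' i| <= rho.
    have -> : z' i.+1 - z' i =
        (z' i.+1 - z i.+1) + ((z i.+1 - z i) - (z' i - z i)).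
      by rewrite opprB addrA -[_ + (z i.+1 - z i)]addrA !addrA !subrK.
    rewrite (le_trans (ler_normD _ _))// (le_trans (lerD b1 (ler_normB _ _)))//.
    by rewrite [`|z i.+1 - _|]distrC; lra.
  have s0 : `|z' i - z' i| <= rho by rewrite subrr normr0 ltW.
  have := local_expansion s0 s1; rewrite a2 b2 opprD addrACA subrr add0r.
  rewrite -scalerBr opprB addrA subrK normrZ => h.
  have tau01 : `|tau j.+1| <= 1.
    have : j.+1%:R / (3 * N)%:R <= 1 :> R.
      by rewrite ler_pdivrMr ?mul1r ?ler_nat// ltr0n muln_gt0.
    have : 0 <= j.+1%:R / (3 * N)%:R :> R by rewrite divr_ge0.
    by rewrite ler_norml /tau; lra.
  have {}h : c0 * (3 / 4) * `|z' i - z' i.+1| <= c0 * (3 / 16) * rho.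
    apply: le_trans h _; rewrite -[leRHS]mul1r; apply: ler_pM => //.
  have c34 : 0 < c0 * (3 / 4) by rewrite mulr_gt0// divr_gt0.
  by rewrite -(ler_pM2l c34); lra.
have [z [zx zy zs Gz]] := deform _ (leqnn _).
have zc i : (i <= N)%N -> z i = x.
  elim: i => // i IH iN; rewrite -(IH (ltnW iN)); apply/esym.
  apply: local_injectivity; first by rewrite distrC (le_trans (zs i iN))//; lra.
  rewrite !Gz ?(ltnW iN)// /tau divff ?subrr ?scale0r//.
  by rewrite pnatr_eq0 muln_eq0.
by rewrite -zy zc.
Qed.

End LocalInverse.
End RowVectors.

(** * Jordan outer content and volume expansion *)

Section OuterContent.
Context (R : realType).

Lemma poly_lt_near0 (p : {poly R}) (y : R) : p.[0] < y ->
  exists2 t, 0 < t & p.[t] < y.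
Proof.
move=> p0y; have /cvgrPdist_lt/(_ (y - p.[0])) := @continuous_horner R p 0.
rewrite subr_gt0 => /(_ p0y) /nbhs_ballP[r /= r0 H].
exists (r / 2); first by rewrite divr_gt0.
have /H /= : ball (0 : R) r (r / 2).
  by rewrite /ball /= sub0r normrN gtr0_norm ?divr_gt0// ltr_pdivrMr//; lra.
by rewrite ltr_norml; lra.
Qed.

Lemma prod_add_lt n (x : 'I_n -> R) (v y : R) : v * \prod_j x j < y ->
  exists2 t, 0 < t & v * \prod_j (x j + t) < y.
Proof.
move=> vy; have pE t : (v *: \prod_j ((x j)%:P + 'X)).[t] = v * \prod_j (x j + t).
  rewrite hornerZ horner_prod; congr (_ * _); apply: eq_bigr => j _.
  by rewrite !hornerE.
have [|t t0] := @poly_lt_near0 (v *: \prod_j ((x j)%:P + 'X)) y.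
  by rewrite pE; under eq_bigr do rewrite addr0.
by rewrite pE; exists t.
Qed.

Context (n : nat).
Implicit Types (c a d x : 'rV[R]_n) (S : set 'rV[R]_n) (v t : R).

Definition box c a : set 'rV[R]_n := [set x | forall j, `|x 0 j - c 0 j| <= a 0 j].

(* [a] lists half-sides, hence a factor [2^n]. *)
Definition vol a : R := \prod_j a 0 j.

Definition pos a := forall j, 0 < a 0 j.

Lemma vol_gt0 a : pos a -> 0 < vol a.
Proof. by move=> a0; apply: prodr_gt0. Qed.

(* The Jordan outer content of [S], in units of [2^n], is at most [v]. *)
Definition content_le S v := forall v', v < v' ->
  exists bs : seq ('rV[R]_n * 'rV[R]_n),
    [/\ forall x, S x -> exists2 b, b \in bs & box b.1 b.2 x,
        forall b, b \in bs -> pos b.2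
      & \sum_(b <- bs) vol b.2 <= v'].

Lemma content_le_box c a : pos a -> content_le (box c a) (vol a).
Proof.
move=> a0 v' av'; exists [:: (c, a)]; split.
- by move=> x cx; exists (c, a); rewrite ?mem_head.
- by move=> b; rewrite inE => /eqP ->.
- by rewrite big_seq1 ltW.
Qed.

Lemma content_leS S S' v v' : S `<=` S' -> v' <= v ->
  content_le S' v' -> content_le S v.
Proof.
move=> SS' vv' H w vw; have [|bs [h1 h2 h3]] := H w; first exact: le_lt_trans vw.
by exists bs; split => // x /SS'/h1.
Qed.

Lemma content_le_lim S v :
  (forall v', v < v' -> content_le S v') -> content_le S v.
Proof. by move=> H v' vv'; apply: (H ((v + v') / 2)); lra. Qed.

Lemma content_leU S S' v v' : content_le S v -> content_le S' v' ->
  content_le (S `|` S') (v + v').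
Proof.
move=> H H' w vw; pose e := (w - (v + v')) / 2.
have [|bs [h1 h2 h3]] := H (v + e); first by rewrite /e; lra.
have [|bs' [h1' h2' h3']] := H' (v' + e); first by rewrite /e; lra.
exists (bs ++ bs'); split.
- move=> x [/h1|/h1'] [b bbs bx]; exists b => //; rewrite mem_cat bbs ?orbT//.
- by move=> b; rewrite mem_cat => /orP[/h2|/h2'].
- by rewrite big_cat/=; move: h3 h3'; rewrite /e; lra.
Qed.

Lemma content_le_set0 : content_le set0 0.
Proof. by move=> v v0; exists [::]; split => //; rewrite big_nil ltW. Qed.

Lemma content_le_bigcup (I : eqType) (s : seq I) (F : I -> set 'rV[R]_n)
    (w : I -> R) S :
  (forall i, i \in s -> content_le (F i) (w i)) ->
  (forall x, S x -> exists2 i, i \in s & F i x) ->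
  content_le S (\sum_(i <- s) w i).
Proof.
elim: s S => [|i s IH] S Fw SF.
  by rewrite big_nil; apply: content_leS content_le_set0 => // x /SF[].
rewrite big_cons; apply: (@content_leS _ (F i `|` (S `&` ~` F i))) => //.
  by move=> x Sx; have [|] := pselect (F i x); [left|right].
apply: content_leU; first by apply: Fw; rewrite mem_head.
apply: IH => [j js|x [/SF[j] + Fj nFi]].
  by apply: Fw; rewrite inE js orbT.
by rewrite inE => /orP[/eqP ji|js]; [rewrite ji in Fj|exists j].
Qed.

(** Along axis [j] the number of boxes exceeds [a 0 j / d 0 j] by at most one, and this extra box
    costs at most the fraction [t] of [a 0 j]. *)
Lemma grid_cover c a d t : pos a -> pos d -> 0 < t ->
  (forall j, d 0 j <= t * a 0 j) ->
  exists s : seq 'rV[R]_n,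
    (forall x, box c a x -> exists2 c', c' \in s & box c' d x) /\
    (size s)%:R * vol d <= (1 + t) ^+ n * vol a.
Proof.
move=> a0 d0 t0 dta; pose m j := (Num.truncn (a 0 j / d 0 j)).+1.
pose center (k : {dffun forall j, 'I_(m j)}) : 'rV[R]_n :=
  \row_j (c 0 j - a 0 j + (2 * (k j)%:R + 1) * d 0 j).
exists [seq center k | k : {dffun forall j, 'I_(m j)}]; split.
  move=> x cax.
  pose u j := (x 0 j - c 0 j + a 0 j) / (2 * d 0 j).
  have u0 j : 0 <= u j.
    have := cax j; rewrite ler_norml => /andP[h _].
    by rewrite divr_ge0 ?mulr_ge0 ?(ltW (d0 j))//; lra.
  have um j : (Num.truncn (u j) < m j)%N.
    rewrite truncn_lt_nat//; apply: le_lt_trans (truncnS_gt _).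
    have := cax j; rewrite ler_norml => /andP[_ h].
    rewrite /u ler_pdivrMr ?mulr_gt0//.
    rewrite (_ : a 0 j / d 0 j * (2 * d 0 j) = 2 * a 0 j); first by lra.
    by rewrite mulrCA mulfVK// gt_eqF.
  exists (center [ffun j => Ordinal (um j)]).
    by apply/mapP; exists [ffun j => Ordinal (um j)]; rewrite ?mem_enum.
  move=> j; rewrite !mxE ffunE /=.
  have -> : x 0 j - (c 0 j - a 0 j + (2 * (Num.truncn (u j))%:R + 1) * d 0 j) =
    (2 * (u j - (Num.truncn (u j))%:R) - 1) * d 0 j.
    have dj : d 0 j != 0 by rewrite gt_eqF.
    by rewrite /u; move: (Num.truncn _)%:R => T; field.
  rewrite normrM (gtr0_norm (d0 j)) -[leRHS]mul1r ler_wpM2r ?(ltW (d0 j))//.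
  have /andP[] := truncn_itv (u0 j); rewrite -natr1 ler_norml; lra.
rewrite size_image card_dep_ffun foldrE big_image /=.
under eq_bigr do rewrite card_ord.
rewrite natr_prod /vol -big_split /= -[n in _ ^+ n]card_ord -prodr_const.
rewrite -big_split /=; apply: ler_prod => j _.
rewrite mulr_ge0 ?(ltW (d0 j))//= /m -natr1 mulrDl mul1r.
have : (Num.truncn (a 0 j / d 0 j))%:R * d 0 j <= a 0 j.
  by rewrite -ler_pdivlMr// truncn_le divr_ge0 ?ltW.
have := dta j; lra.
Qed.

Lemma small_scale (bs : seq ('rV[R]_n * 'rV[R]_n)) d t : pos d -> 0 < t ->
  (forall b, b \in bs -> pos b.2) ->
  exists2 r, 0 < r & forall b, b \in bs -> forall j, r * d 0 j <= t * b.2 0 j.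
Proof.
move=> d0 t0; elim: bs => [_|b bs IH bs0]; first by exists 1.
have [|r r0 rbs] := IH.
  by move=> b' b'bs; apply: bs0; rewrite inE b'bs orbT.
have b0 : pos b.2 by apply: bs0; rewrite mem_head.
pose q := \big[Num.min/r]_j (t * b.2 0 j / d 0 j).
have q0 : 0 < q.
  by rewrite /q; apply/bigmin_gtP; split=> // j _; rewrite divr_gt0 ?mulr_gt0.
exists q => // b'; rewrite inE => /orP[/eqP -> j|/rbs h j].
  by rewrite -ler_pdivlMr//; exact: bigmin_le.
by apply: le_trans (h j); rewrite ler_wpM2r ?(ltW (d0 j))//; exact: bigmin_le_id.
Qed.

Lemma scale_pos d r : 0 < r -> pos d -> pos (r *: d).
Proof. by move=> r0 d0 j; rewrite mxE mulr_gt0. Qed.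

Lemma vol_scale d r : vol (r *: d) = r ^+ n * vol d.
Proof.
rewrite /vol -[n in _ ^+ n]card_ord -prodr_const -big_split /=.
by apply: eq_bigr => j _; rewrite mxE.
Qed.

Lemma pow_add1_le (v y : R) : 0 <= v -> v < y ->
  exists2 t, 0 < t & (1 + t) ^+ n * v <= y.
Proof.
move=> v0 vy; have [|t t0] := @prod_add_lt n (fun=> 1) v y.
  by rewrite prodr_const expr1n mulr1.
by rewrite prodr_const card_ord mulrC => /ltW h; exists t.
Qed.

End OuterContent.

(** * Outer content under linear maps *)

Section Linear.
Context (R : realType) (n : nat).
Implicit Types (c a d x : 'rV[R]_n) (S : set 'rV[R]_n) (v t : R) (T : 'M[R]_n).

Lemma box_mulmx_sub c d (beta : 'rV[R]_n) T x :
  (forall j, \sum_i d 0 i * `|T i j| <= beta 0 j) ->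
  box c d x -> box (c *m T) beta (x *m T).
Proof.
move=> Tb cx j; have -> : (x *m T) 0 j - (c *m T) 0 j = ((x - c) *m T) 0 j.
  by rewrite mulmxBl !mxE.
rewrite mxE; apply: le_trans (Tb j); apply: le_trans (ler_norm_sum _ _ _) _.
by apply: ler_sum => i _; rewrite normrM ler_wpM2r// !mxE; exact: cx.
Qed.

(** Refine a cover of [S] into tiny boxes of the single shape [d]. Each is sent by [T] into a box of
    shape [beta], so every volume grows by the same ratio. *)
Lemma content_le_mulmx_shape d (beta : 'rV[R]_n) T S v : pos d -> pos beta ->
  (forall j, \sum_i d 0 i * `|T i j| <= beta 0 j) ->
  content_le S v -> content_le [set x *m T | x in S] (v * (vol beta / vol d)).
Proof.
move=> d0 beta0 Tb; pose r := vol beta / vol d.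
have r0 : 0 < r by rewrite divr_gt0 ?vol_gt0.
have boxT c a : pos a ->
    content_le [set x *m T | x in box c a] (vol a * r).
  move=> a0 v' av'.
  have [||t t0 tv] := @pow_add1_le R n (vol a) (v' / r).
  - by rewrite ltW// vol_gt0.
  - by rewrite ltr_pdivlMr.
  have [|s s0 sa] := @small_scale R n [:: (c, a)] d t d0 t0.
    by move=> b; rewrite inE => /eqP ->.
  have sda j : (s *: d) 0 j <= t * a 0 j.
    by rewrite mxE; apply: (sa (c, a)); rewrite mem_head.
  have [cs [cs1 cs2]] := grid_cover c a0 (scale_pos s0 d0) t0 sda.
  exists [seq (c' *m T, s *: beta) | c' <- cs]; split.
  - move=> _ [x /cs1[c' c's c'x] <-].
    exists (c' *m T, s *: beta); first by apply/mapP; exists c'.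
    apply: box_mulmx_sub c'x => j; rewrite mxE.
    under eq_bigr do rewrite mxE -mulrA.
    by rewrite -mulr_sumr ler_wpM2l// ltW.
  - by move=> _ /mapP[c' _ ->]; exact: scale_pos.
  - rewrite big_map /= big_const_seq count_predT iter_addr addr0 -mulr_natl.
    rewrite vol_scale.
    have : (size cs)%:R * vol (s *: d) * r <= v'.
      by rewrite -ler_pdivlMr//; apply: le_trans cs2 tv.
    apply: le_trans; rewrite vol_scale /r le_eqVlt; apply/orP; left; apply/eqP.
    by field; rewrite gt_eqF// vol_gt0.
move=> Sv; apply: content_le_lim => v' vv'.
have [|bs [bs1 bs2 bs3]] := Sv (v' / r); first by rewrite ltr_pdivlMr.
apply: (@content_leS _ _ _ [set x *m T | x in S] _ (\sum_(b <- bs) vol b.2 * r)).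
- by [].
- by rewrite -mulr_suml -ler_pdivlMr.
apply: (@content_le_bigcup _ _ _ _ (fun b => [set x *m T | x in box b.1 b.2])).
  by move=> b /bs2; exact: boxT.
by move=> _ [x /bs1[b bbs bx] <-]; exists b => //; exists x.
Qed.

(* [h] is the order for which [T] is triangular; the boxes of shape [K ^ h]
   are so elongated, for large [K], that the off-diagonal part of [T] hardly
   enlarges them. *)
Lemma content_le_mulmx_trig (h : 'I_n -> nat) T S v :
  (forall i j, i != j -> (h j <= h i)%N -> T i j = 0) ->
  content_le S v -> content_le [set x *m T | x in S] (v * \prod_j `|T j j|).
Proof.
move=> Th Sv; apply: content_le_lim => v' vv'.
have [t t0 tv'] := prod_add_lt vv'.
pose B := \sum_i \sum_j `|T i j|.
have B0 : 0 <= B by do 2 (apply: sumr_ge0 => ? _).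
(* This gives [B <= t * K]. The off-diagonal entries of column [j] only meet half-sides of at most
   [K ^+ (h j).-1], hence contribute at most [K ^+ h j * t]. *)
pose K := 1 + B / t.
have K1 : 1 <= K by rewrite lerDl divr_ge0// ltW.
have BK : B <= t * K.
  have -> : t * K = t + B by rewrite /K; field; rewrite gt_eqF.
  by rewrite lerDr ltW.
have K0 : 0 < K by apply: lt_le_trans K1.
pose d : 'rV[R]_n := \row_j K ^+ h j.
pose beta : 'rV[R]_n := \row_j (K ^+ h j * (`|T j j| + t)).
have d0 : pos d by move=> j; rewrite mxE exprn_gt0.
have beta0 : pos beta.
  by move=> j; rewrite mxE mulr_gt0 ?exprn_gt0// ltr_wpDl.
apply: (@content_leS _ _ _ [set x *m T | x in S] _
  (v * (vol beta / vol d))) => //; last first.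
  apply: content_le_mulmx_shape => // j; rewrite !mxE (bigD1 j)//= mxE mulrDr.
  rewrite lerD2l; case: (posnP (h j)) => [hj0|hj].
    rewrite big1 ?mulr_ge0 ?exprn_ge0 ?ltW// => i ij.
    by rewrite Th ?hj0// normr0 mulr0.
  have -> : K ^+ h j * t = K ^+ (h j).-1 * (t * K).
    by rewrite -[in LHS](prednK hj) exprSr -mulrA [K * t]mulrC.
  apply: (@le_trans _ _ (K ^+ (h j).-1 * B)); last first.
    by rewrite ler_wpM2l// exprn_ge0// ltW.
  apply: (@le_trans _ _ (\sum_(i < n | i != j) K ^+ (h j).-1 * `|T i j|)).
    apply: ler_sum => i ij; rewrite mxE.
    case: (leqP (h j) (h i)) => hij; first by rewrite Th// normr0 !mulr0.
    by rewrite ler_wpM2r// ler_weXn2l// -ltnS (prednK hj).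
  rewrite -mulr_sumr ler_wpM2l ?exprn_ge0 ?(ltW K0)//.
  apply: (@le_trans _ _ (\sum_i `|T i j|)).
    by rewrite [leRHS](bigD1 j)//= lerDr.
  by apply: ler_sum => i _; rewrite (bigD1 j)//= lerDl sumr_ge0.
suff -> : vol beta / vol d = \prod_j (`|T j j| + t) by exact: ltW.
rewrite /vol; under eq_bigr do rewrite mxE; rewrite big_split /=.
under [X in _ / X]eq_bigr do rewrite mxE.
by rewrite mulrC mulKf// gt_eqF// prodr_gt0// => j _; rewrite exprn_gt0.
Qed.

Lemma content_le_perm (s : {perm 'I_n}) S v :
  content_le S v -> content_le [set x *m perm_mx s | x in S] v.
Proof.
move=> Sv; have one0 : pos (const_mx 1 : 'rV[R]_n) by move=> j; rewrite mxE.
have := @content_le_mulmx_shape (const_mx 1) (const_mx 1) (perm_mx s) S v one0 one0.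
rewrite divff ?gt_eqF ?vol_gt0// mulr1; apply => // j.
rewrite (bigD1 (s^-1%g j))//= !mxE perm.permKV eqxx normr1 mulr1 big1 ?addr0//.
move=> i ij; rewrite !mxE (_ : (s i == j) = false) ?normr0 ?mulr0//.
by apply: contraNF ij => /eqP <-; rewrite perm.permK.
Qed.

End Linear.

(** By the LUP factorization: the permutation and the unit triangular factor [L] do not enlarge the
    content, and the diagonal of [U] carries [|\det A|]. The order [n - i] makes the lower
    triangular [L] fit the convention for which [U] has the natural order. *)
Lemma content_le_mulmx (R : realType) n (A : 'M[R]_n.+1) S v :
  A \in unitmx -> content_le S v ->
  content_le [set x *m A | x in S] (v * `|\det A|).
Proof.
move=> Au Sv.
have := cormen_lup_correct A; have := cormen_lup_perm A.
have := cormen_lup_detL A; have := @cormen_lup_lower _ _ A.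
have := @cormen_lup_upper _ _ A.
case: (cormen_lup A) => [[P L] U] /= Uu Ll detL /is_perm_mxP[s ->] PA.
have {}PA : A = perm_mx s^-1 *m L *m U.
  rewrite -mulmxA -[L *m U]/(L * U) -PA -[_ * _]/(_ *m _) mulmxA -perm_mxM.
  by rewrite mulVg perm_mx1 mul1mx.
have detA : `|\det A| = \prod_j `|U j j|.
  rewrite PA !det_mulmx detL mulr1 normrM det_perm normrX normrN1 expr1n mul1r.
  rewrite -det_tr det_trig; last by apply/is_trig_mxP => i j ij; rewrite mxE Uu.
  by rewrite normr_prod; apply: eq_bigr => j _; rewrite mxE.
have Ltrig (i j : 'I_n.+1) : i != j -> (n - j <= n - i)%N -> L i j = 0.
  move=> ij ji; rewrite Ll ?(negbTE ij)//.
  by have := ltn_ord i; have := ltn_ord j; lia.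
have Utrig (i j : 'I_n.+1) : i != j -> (j <= i)%N -> U i j = 0.
  move=> ij ji; apply: Uu; rewrite ltn_neqAle ji andbT.
  by apply: contra ij => /eqP/val_inj ->.
have LE : \prod_j `|L j j| = 1.
  by rewrite big1// => j _; rewrite Ll// eqxx normr1.
have := @content_le_mulmx_trig _ _ (fun i => n - i)%N _ _ _ Ltrig
  (content_le_perm s^-1 Sv).
rewrite LE mulr1 => /(@content_le_mulmx_trig _ _ (fun i => i) _ _ _ Utrig).
rewrite -detA.
apply: content_leS => // _ [x Sx <-].
exists (x *m perm_mx s^-1 *m L); last by rewrite PA !mulmxA.
by exists (x *m perm_mx s^-1) => //; exists x.
Qed.

(** * Outer content of preimages under a nonlinear map *)

Section Nonlinear.
Context (R : realType) (n' : nat).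
Local Notation n := n'.+1.
Context (G : 'rV[R]_n -> 'rV[R]_n) (L : 'rV[R]_n -> 'M[R]_n) (c0 e rho : R).
Hypotheses (cG : continuous G) (c0_gt0 : 0 < c0) (ec0 : e <= c0 / 4).
Hypotheses (rho_gt0 : 0 < rho) (e_ge0 : 0 <= e).
Hypotheses (GL : strict_approx G L e rho) (Lunit : forall x, L x \in unitmx).
Hypothesis Lge : forall x (v : 'rV[R]_n), c0 * `|v| <= `|v *m L x|.
Hypothesis Ginj : injective G.
Context (sigma : R).
Hypotheses (sigma_gt0 : 0 < sigma) (Lsigma : forall x, sigma <= `|\det (L x)|).

Let q := 1 + 8 * e / c0.

(** All preimages of the cube lie within [8 * d / c0] of one of them, [x0]: the local inverse finds
    a preimage there, and injectivity of [G] makes it the only one. At that distance [G] differs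
    from its affine approximation by at most [8 * e * d / c0], whence the inflated half-side
    [q * d]; then [invmx (L x0)] divides the content by at least [sigma]. *)
Lemma small_preimage_content S (c : 'rV[R]_n) d : 0 < d -> 8 * d <= c0 * rho ->
  content_le (S `&` G @^-1` box c (const_mx d)) ((q * d) ^+ n / sigma).
Proof.
move=> d0 drho.
have q0 : 0 < q by rewrite ltr_wpDr// divr_ge0 ?mulr_ge0// ltW.
have qd0 : 0 <= (q * d) ^+ n / sigma.
  by rewrite divr_ge0 ?ltW// exprn_gt0// mulr_gt0.
have [[x0 [Sx0 Gx0]]|empty] := pselect
    (exists x0, (S `&` G @^-1` box c (const_mx d)) x0); last first.
  apply: (@content_leS _ _ _ set0 _ 0) => //; last exact: content_le_set0.
  by move=> x Sx; apply: empty; exists x.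
pose c' := c - G x0.
pose Q := [set y *m invmx (L x0) | y in box c' (const_mx (q * d))].
apply: (@content_leS _ _ _ [set x0 + y | y in Q] _ ((q * d) ^+ n / sigma)) => //.
  move=> x [Sx Gx]; exists (x - x0); last by rewrite addrC subrK.
  exists ((x - x0) *m L x0); last by rewrite mulmxK.
  have Gd : `|G x - G x0| <= 2 * d.
    apply: rV_norm_le; first by rewrite mulr_ge0// ltW.
    move=> j; have := Gx j; have := Gx0 j; rewrite !mxE.
    by rewrite !ler_norml; lra.
  have xx0 : `|x - x0| <= 8 * d / c0.
    have [|||y yx0 Gy] :=
        @local_surjection R n G L c0 e rho cG c0_gt0 ec0 GL Lunit Lge x0 (G x)
          (8 * d / c0).
    - by apply: divr_ge0; [apply: mulr_ge0 => //; exact: ltW|exact: ltW].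
    - by rewrite ler_pdivrMr// [rho * _]mulrC.
    - apply: le_trans Gd _; rewrite le_eqVlt; apply/orP; left; apply/eqP.
      by field; rewrite gt_eqF.
    by rewrite -(Ginj Gy).
  have x0r : `|x0 - x0| <= rho by rewrite subrr normr0 ltW.
  have xr : `|x - x0| <= rho.
    by rewrite (le_trans xx0)// ler_pdivrMr// [rho * _]mulrC.
  have := GL xr x0r => h j; rewrite !mxE.
  have := le_trans (coord_le_norm _ j) h; rewrite !mxE.
  have : e * `|x - x0| <= e * (8 * d / c0) by rewrite ler_wpM2l.
  have := Gx j; rewrite !mxE.
  have -> : q * d = d + e * (8 * d / c0) by rewrite /q; field; rewrite gt_eqF.
  by rewrite !ler_norml; lra.
suff : content_le Q ((q * d) ^+ n / sigma).
  move=> QH v' qv'; have [bs [b1 b2 b3]] := QH v' qv'.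
  exists [seq (x0 + b.1, b.2) | b <- bs]; split.
  - move=> _ [y /b1[b bbs yb] <-]; exists (x0 + b.1, b.2).
      by apply/mapP; exists b.
    by move=> j; have := yb j; rewrite !mxE opprD addrACA subrr add0r.
  - by move=> _ /mapP[b /b2 ? ->].
  - by rewrite big_map.
have pq : pos (const_mx (q * d) : 'rV[R]_n).
  by move=> j; rewrite mxE mulr_gt0.
have := content_le_mulmx (_ : invmx (L x0) \in unitmx) (content_le_box c' pq).
rewrite unitmx_inv => /(_ (Lunit x0)); apply: content_leS => //.
rewrite det_inv normfV /vol.
under eq_bigr do rewrite mxE; rewrite prodr_const card_ord.
rewrite ler_wpM2l ?exprn_ge0 ?mulr_ge0 ?(ltW q0) ?(ltW d0)//.
by rewrite lef_pV2// posrE// (lt_le_trans sigma_gt0).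
Qed.

Lemma content_le_preimage S v :
  content_le [set G x | x in S] v -> content_le S (v * (q ^+ n / sigma)).
Proof.
pose r := q ^+ n / sigma; rewrite -/r.
have q0 : 0 < q by rewrite ltr_wpDr// divr_ge0 ?mulr_ge0// ltW.
have r0 : 0 < r by rewrite divr_gt0// exprn_gt0.
have boxG c a : pos a -> content_le (S `&` G @^-1` box c a) (vol a * r).
  move=> a0; apply: content_le_lim => v' av'.
  have [||t t0 tv] := @pow_add1_le R n (vol a) (v' / r).
  - by rewrite ltW// vol_gt0.
  - by rewrite ltr_pdivlMr.
  have one0 : pos (const_mx 1 : 'rV[R]_n) by move=> j; rewrite mxE.
  have [|s s0 sa] := @small_scale R n [:: (c, a)] (const_mx 1) t one0 t0.
    by move=> b; rewrite inE => /eqP ->.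
  pose d := Num.min s (c0 * rho / 8).
  have d0 : 0 < d by rewrite lt_min s0 divr_gt0// mulr_gt0.
  have ds : d <= s by rewrite ge_min lexx.
  have drho : 8 * d <= c0 * rho.
    by rewrite mulrC -ler_pdivlMr// ge_min lexx orbT.
  have pd : pos (const_mx d : 'rV[R]_n) by move=> j; rewrite mxE.
  have sda j : (const_mx d : 'rV[R]_n) 0 j <= t * a 0 j.
    rewrite mxE (le_trans ds)//; have := sa (c, a) (mem_head _ _) j.
    by rewrite mxE mulr1.
  have [cs [cs1 cs2]] := grid_cover c a0 pd t0 sda.
  have vd : vol (const_mx d : 'rV[R]_n) = d ^+ n.
    by rewrite /vol; under eq_bigr do rewrite mxE; rewrite prodr_const card_ord.
  apply: (@content_leS _ _ _ (S `&` G @^-1` box c a) _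
      (\sum_(c' <- cs) (q * d) ^+ n / sigma)) => //.
    rewrite big_const_seq count_predT iter_addr addr0 -mulr_natl.
    have : (size cs)%:R * vol (const_mx d : 'rV[R]_n) * r <= v'.
      by rewrite -ler_pdivlMr//; apply: le_trans cs2 tv.
    rewrite vd exprMn; apply: le_trans; rewrite le_eqVlt; apply/orP; left.
    by apply/eqP; rewrite /r; ring.
  apply: (@content_le_bigcup _ _ _ _
      (fun c' => S `&` G @^-1` box c' (const_mx d))).
    by move=> c' _; exact: small_preimage_content.
  by move=> x [Sx /cs1[c' c's Gx]]; exists c'.
move=> Sv; apply: content_le_lim => v' vv'.
have [|bs [bs1 bs2 bs3]] := Sv (v' / r); first by rewrite ltr_pdivlMr.
apply: (@content_leS _ _ _ S _ (\sum_(b <- bs) vol b.2 * r)) => //.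
  by rewrite -mulr_suml -ler_pdivlMr.
apply: (@content_le_bigcup _ _ _ _ (fun b => S `&` G @^-1` box b.1 b.2)).
  by move=> b /bs2; exact: boxG.
by move=> x Sx; have [|b bbs bx] := bs1 (G x); [exists x|exists b].
Qed.

End Nonlinear.

(** * Growth of the iterates of a cube *)

Section Growth.
Context (R : realType) (n' : nat).
Local Notation n := n'.+1.

Lemma box_content_gt0 (c : 'rV[R]_n) (a : R) : 0 < a ->
  ~ content_le (box c (const_mx a)) 0.
Proof.
move=> a0 H; have w0 : 0 < (a / 2) ^+ n / 8.
  by rewrite divr_gt0// exprn_gt0// divr_gt0.
have [bs [bs1 bs2 bs3]] := H _ w0.
have one0 : pos (const_mx 1 : 'rV[R]_n) by move=> j; rewrite mxE.
have [|t t0 tv] := @pow_add1_le R n 1 2 ler01; first by rewrite ltr1n.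
have [s s0 sbs] := small_scale one0 t0 bs2.
pose d := Num.min s (a / 6).
have d0 : 0 < d by rewrite lt_min s0 divr_gt0.
have da : 6 * d <= a by rewrite mulrC -ler_pdivlMr// ge_min lexx orbT.
have ds : d <= s by rewrite ge_min lexx.
have pd : pos (const_mx d : 'rV[R]_n) by move=> j; rewrite mxE.
have vd : vol (const_mx d : 'rV[R]_n) = d ^+ n.
  by rewrite /vol; under eq_bigr do rewrite mxE; rewrite prodr_const card_ord.
have [cs cs1 cs2] : exists2 cs : seq 'rV[R]_n,
    (forall x, box c (const_mx a) x -> exists2 c', c' \in cs & box c' (const_mx d) x)
    & (size cs)%:R * d ^+ n <= 2 * ((a / 2) ^+ n / 8).
  have : exists2 cs : seq 'rV[R]_n,
    (forall x b, b \in bs -> box b.1 b.2 x ->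
      exists2 c', c' \in cs & box c' (const_mx d) x)
    & (size cs)%:R * d ^+ n <= (1 + t) ^+ n * \sum_(b <- bs) vol b.2.
    elim: bs {bs1 bs3} bs2 sbs => [_ _|b bs IH bs2 sbs].
      by exists [::] => //; rewrite big_nil mul0r mulr0.
    have [||cs cs1 cs2] := IH.
    - by move=> b' b'bs; apply: bs2; rewrite inE b'bs orbT.
    - by move=> b' b'bs; apply: sbs; rewrite inE b'bs orbT.
    have sdb j : (const_mx d : 'rV[R]_n) 0 j <= t * b.2 0 j.
      by have := sbs b (mem_head _ _) j; rewrite !mxE; lra.
    have [ds1 [ds2 ds3]] := grid_cover b.1 (bs2 b (mem_head _ _)) pd t0 sdb.
    exists (ds1 ++ cs).
      move=> x b'; rewrite inE => /orP[/eqP ->|b'bs] bx.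
        by have [c' c's c'x] := ds2 x bx; exists c' => //; rewrite mem_cat c's.
      have [c' c's c'x] := cs1 x b' b'bs bx.
      by exists c' => //; rewrite mem_cat c's orbT.
    rewrite size_cat natrD mulrDl big_cons mulrDr.
    by rewrite lerD// -vd.
  move=> [cs h1 h2]; exists cs.
    by move=> x /bs1[b bbs bx]; apply: h1 bbs bx.
  apply: le_trans h2 _; apply: ler_pM => //.
  - by rewrite exprn_ge0// addr_ge0// ltW.
  - by rewrite big_seq sumr_ge0// => b /bs2 b0; rewrite ltW// vol_gt0.
  - by rewrite mulr1 in tv.
pose M := Num.truncn (2 * a / (3 * d)).
have M1 : 3 * d * M%:R <= 2 * a.
  rewrite mulrC -ler_pdivlMr ?mulr_gt0// truncn_le.
  by rewrite divr_ge0 ?mulr_ge0 ?(ltW a0) ?(ltW d0).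
have M2 : 2 * a <= 3 * d * (M%:R + 1).
  by rewrite [leRHS]mulrC -ler_pdivrMr ?mulr_gt0// natr1 ltW// /M truncnS_gt.
(* Points at mutual distance at least [3 * d] lie in different boxes of half-side
   [d], which bounds the number of these boxes from below. *)
pose pt (k : {ffun 'I_n -> 'I_M}) : 'rV[R]_n :=
  \row_j (c 0 j - a + 3 * d * (k j)%:R).
have ptb k : box c (const_mx a) (pt k).
  move=> j; rewrite !mxE ler_norml.
  have kM : (k j)%:R <= M%:R :> R by rewrite ler_nat ltnW.
  have : 0 <= 3 * d * (k j)%:R by rewrite !mulr_ge0// ltW.
  have : 3 * d * (k j)%:R <= 3 * d * M%:R by rewrite ler_wpM2l// mulr_ge0// ltW.
  lra.
have /choice[f fP] : forall k, exists c', c' \in cs /\ box c' (const_mx d) (pt k).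
  by move=> k; have [c' ? ?] := cs1 _ (ptb k); exists c'.
have far (u u' z b : R) : 3 * d * (u + 1) <= 3 * d * u' ->
    `|b + 3 * d * u - z| <= d -> `|b + 3 * d * u' - z| <= d -> False.
  by have d0' : 0 < d by []; rewrite !ler_norml; lra.
have finj : injective f.
  move=> k k' fkk'; apply/ffunP => j; apply/val_inj => /=.
  have [_ /(_ j)] := fP k; have [_ /(_ j)] := fP k'; rewrite fkk' !mxE.
  have [kk'|kk'|//] := ltngtP (k j) (k' j) => fk' fk.
    have := @far (k j)%:R (k' j)%:R _ _ _ fk fk'; case.
    by rewrite ler_wpM2l ?mulr_ge0 ?(ltW d0)// natr1 ler_nat.
  have := @far (k' j)%:R (k j)%:R _ _ _ fk' fk; case.
  by rewrite ler_wpM2l ?mulr_ge0 ?(ltW d0)// natr1 ler_nat.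
have szM : (M ^ n <= size cs)%N.
  have -> : (M ^ n)%N = size [seq f k | k : {ffun 'I_n -> 'I_M}].
    by rewrite size_image card_ffun !card_ord.
  apply: uniq_leq_size; first by rewrite map_inj_uniq// enum_uniq.
  by move=> _ /mapP[k _ ->]; have [] := fP k.
have : (a / 2) ^+ n <= 2 * ((a / 2) ^+ n / 8).
  apply: le_trans cs2; apply: (@le_trans _ _ ((M ^ n)%:R * d ^+ n)).
    rewrite natrX -exprMn; apply: lerXn2r.
    - by rewrite nnegrE divr_ge0 ?(ltW a0).
    - by rewrite nnegrE mulr_ge0 ?(ltW d0).
    - lra.
  by rewrite ler_wpM2r ?exprn_ge0 ?(ltW d0)// ler_nat.
have : 0 < (a / 2) ^+ n by rewrite exprn_gt0// divr_gt0.
lra.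
Qed.

Context (G : 'rV[R]_n -> 'rV[R]_n) (L : 'rV[R]_n -> 'M[R]_n) (c0 e rho : R).
Hypotheses (cG : continuous G) (c0_gt0 : 0 < c0) (ec0 : e <= c0 / 4).
Hypotheses (rho_gt0 : 0 < rho) (e_ge0 : 0 <= e).
Hypotheses (GL : strict_approx G L e rho) (Lunit : forall x, L x \in unitmx).
Hypothesis Lge : forall x (v : 'rV[R]_n), c0 * `|v| <= `|v *m L x|.
Hypothesis Ginj : injective G.
Context (sigma : R).
Hypotheses (sigma_gt0 : 0 < sigma) (Lsigma : forall x, sigma <= `|\det (L x)|).
Hypothesis eq_sigma : (1 + 8 * e / c0) ^+ n < sigma.

(** Otherwise every iterate of the cube [B] lies in a cube of half-side [D]. Pulling that cube back
    [k] times bounds the content of [B] by [D ^+ n * tau ^+ k] with [tau < 1], so [B] has content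
    0. *)
Lemma iterates_grow (p : 'rV[R]_n) (r D : R) : 0 < r -> 0 < D ->
  exists k x y, [/\ `|x - p| <= r, `|y - p| <= r
    & D < `|iter k G x - iter k G y|].
Proof.
move=> r0 D0; apply: contrapT => small.
pose B : set 'rV[R]_n := box p (const_mx r).
have Br x : B x -> `|x - p| <= r.
  move=> Bx; apply: rV_norm_le; first exact: ltW.
  by move=> j; have := Bx j; rewrite !mxE.
have Bp : B p by move=> j; rewrite mxE subrr normr0 ltW.
pose tau := (1 + 8 * e / c0) ^+ n / sigma.
have tau0 : 0 <= tau.
  rewrite divr_ge0 ?exprn_ge0 ?(ltW sigma_gt0)//.
  by rewrite addr_ge0// divr_ge0 ?mulr_ge0// ltW.
have iterB k : content_le [set iter k G x | x in B] (D ^+ n).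
  have pD : pos (const_mx D : 'rV[R]_n) by move=> j; rewrite mxE.
  have := content_le_box (iter k G p) pD.
  rewrite /vol; under eq_bigr do rewrite mxE.
  rewrite prodr_const card_ord; apply: content_leS => // _ [x Bx <-] j.
  rewrite mxE; have := coord_le_norm (iter k G x - iter k G p) j.
  rewrite !mxE => /le_trans; apply; rewrite leNgt; apply/negP => DG.
  apply: small; exists k, x, p; split => //; first exact: Br.
  by rewrite subrr normr0 ltW.
(* The alternative [k < j] absorbs the indices at which [k - j] is truncated. *)
have Bk k j :
    content_le [set iter (k - j) G x | x in B] (D ^+ n * tau ^+ j) \/ (k < j)%N.
  elim: j => [|j [IH|jk]].
  - by left; rewrite subn0 expr0 mulr1.
  - case: (ltnP j k) => jk; last by right; rewrite ltnS.
    left; rewrite [tau ^+ _]exprSr mulrA.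
    apply: (@content_le_preimage R n' G L c0 e rho) => //.
    apply: content_leS IH => // _ [_ [x Bx <-] <-]; exists x => //.
    by rewrite -iterS -subSn// subSS.
  - by right; rewrite ltnS ltnW.
have Bv k : content_le B (D ^+ n * tau ^+ k).
  have [|] := Bk k k; last by rewrite ltnn.
  by rewrite subnn; apply: content_leS => // x Bx; exists x.
apply: (@box_content_gt0 p r r0) => v v0.
have tau1 : `|tau| < 1 by rewrite ger0_norm// ltr_pdivrMr// mul1r.
have /cvgrPdist_lt/(_ (v / D ^+ n)) := cvg_expr tau1.
rewrite divr_gt0 ?exprn_gt0// => /(_ erefl)[k _ /(_ k (leqnn k))] /=.
rewrite sub0r normrN ger0_norm ?exprn_ge0// => tk.
by apply: (Bv k); rewrite mulrC -ltr_pdivlMr ?exprn_gt0.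
Qed.

End Growth.

(** * Arcs and chains *)

Section Arcs.
Context (R : realType) (n : nat).
Implicit Types (x y z p : 'rV[R]_n) (S : set 'rV[R]_n).

(** The free length [T] lets pieces be appended without reparametrization, and [T = 0] admits the
    one-point arc from which a chain starts. *)
Definition arc_in S p q := exists T : R, exists c : R -> 'rV[R]_n,
  [/\ 0 <= T, continuous c, c 0 = p /\ c T = q,
      {in `[0, T] &, injective c} & forall t, t \in `[0, T] -> S (c t)].

Definition line x y := fun t : R => x + t *: (y - x).

Lemma line_continuous x y : continuous (line x y).
Proof.
rewrite /line => t; apply: cvgD; first exact: cvg_cst.
by apply: cvgZr_tmp; exact: cvg_id.
Qed.

(* The arc is cut at the first time it hits the segment [x, y]. *)
Lemma arc_in_extend S p x y : arc_in S p x ->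
  (forall t, t \in `[0, 1] -> S (line x y t)) -> arc_in S p y.
Proof.
move=> [T [c [T0 cc [c0 cT] cinj cS]]] xyS.
pose E := line x y @` [set` `[0, 1]].
have Ecl : closed E.
  apply: compact_closed; first exact: norm_hausdorff.
  apply: continuous_compact; last exact: segment_compact.
  exact/continuous_subspaceT/line_continuous.
pose A := [set` `[0, T]] `&` c @^-1` E.
have Ac : compact A.
  apply: compact_closedI; first exact: segment_compact.
  by apply: preimage_closed => // t _; exact: cc.
have A0 : A !=set0.
  exists T; split; first by rewrite /= in_itv /= T0 lexx.
  by exists 0; rewrite /= ?in_itv /= ?lexx ?ler01// /line scale0r addr0 cT.
have [|t0 + t0min] := @compact_EVT_min _ _ idfun A A0 Ac.
  by apply: continuous_subspaceT => t; exact: cvg_id.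
rewrite inE => -[t0T [s0 s01 xys0]].
have {}t0min t : t \in `[0, T] -> E (c t) -> t0 <= t.
  by move=> tT Et; apply: t0min; rewrite inE.
have t00 : 0 <= t0 by move: t0T; rewrite /= in_itv /= => /andP[].
have t0T' : t0 <= T by move: t0T; rewrite /= in_itv /= => /andP[].
have sub t : t \in `[0, t0] -> t \in `[0, T].
  by rewrite !in_itv /= => /andP[-> h]; apply: le_trans h t0T'.
(* If the segment is first hit at [y] itself, the cut arc is the answer; appending a constant piece
   would destroy injectivity. *)
have [cy|cy] := eqVneq (c t0) y.
  exists t0, c; split => //; first by move=> s t /sub sT /sub tT; exact: cinj.
  by move=> t /sub; exact: cS.
(* Written with [min] and [max], the concatenation is continuous by composition, with no gluing
   argument. *)
pose c' t := c (Num.min t t0) + Num.max (t - t0) 0 *: (y - c t0).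
have c'1 t : t <= t0 -> c' t = c t.
  move=> tt0; rewrite /c' (min_idPl tt0) (_ : Num.max _ _ = 0).
    by rewrite scale0r addr0.
  by apply/max_idPr; rewrite subr_le0.
have c'2 t : t0 <= t -> c' t = c t0 + (t - t0) *: (y - c t0).
  by move=> tt0; rewrite /c' (min_idPr tt0) (max_idPl _)// subr_ge0.
have c'E t : t \in `[t0, t0 + 1] -> exists2 s, s \in `[0, 1] & c' t = line x y s.
  rewrite in_itv /= => /andP[t1 t2]; move: s01; rewrite /= in_itv /= => /andP[s1 s2].
  exists (s0 + (t - t0) * (1 - s0)).
    have t3 : 0 <= t - t0 by rewrite subr_ge0.
    have t4 : t - t0 <= 1 by rewrite lerBlDl.
    rewrite in_itv /= addr_ge0 ?mulr_ge0 ?subr_ge0//=.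
    have : (t - t0) * (1 - s0) <= 1 * (1 - s0) by rewrite ler_wpM2r// subr_ge0.
    lra.
  by rewrite c'2// -xys0 /line; apply/rowP => i; rewrite !mxE; ring.
exists (t0 + 1), c'; split.
- by rewrite addr_ge0.
- move=> t; apply: cvgD.
    apply: (@continuous_comp _ _ _ (fun t => Num.min t t0) c); last exact: cc.
    by apply: continuous_min; [exact: cvg_id|exact: cst_continuous].
  apply: cvgZr_tmp.
  apply: (@continuous_max R R (fun t => t - t0) (fun=> 0)); last first.
    exact: cst_continuous.
  by apply: cvgB; [exact: cvg_id|exact: cvg_cst].
- split; first by rewrite c'1.
  rewrite c'2 ?lerDl// [t0 + 1]addrC addrK scale1r addrC subrK//.
- have key s t : s \in `[0, t0] -> t \in `[t0, t0 + 1] -> t0 < t ->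
      c' s = c' t -> False.
    move=> s0t0; move: (s0t0); rewrite in_itv /= => /andP[_ st0] tt0 lt0t.
    have [u u01 cu] := c'E t tt0; rewrite cu c'1// => csu.
    have t0s : t0 <= s by apply: t0min; [exact: sub|exists u].
    have {t0s}st : s = t0 by apply/eqP; rewrite eq_le st0.
    move: csu; rewrite -cu st c'2 ?ltW// => /eqP.
    rewrite -subr_eq0 opprD addrA subrr sub0r oppr_eq0 scaler_eq0.
    by rewrite !subr_eq0 gt_eqF//= eq_sym (negbTE cy).
  have itvP t : t \in `[0, t0 + 1] ->
      t \in `[0, t0] \/ t \in `[t0, t0 + 1] /\ t0 < t.
    rewrite !in_itv /= => /andP[-> ->]; case: (leP t t0) => h; [by left|right].
    by rewrite ltW.
  move=> s t /itvP[sI|[sI st]] /itvP[tI|[tI tt]].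
  + rewrite !c'1; [|by move: tI; rewrite in_itv /= => /andP[]
                  |by move: sI; rewrite in_itv /= => /andP[]].
    by apply: cinj; exact: sub.
  + by move=> /(key _ _ sI tI tt).
  + by move=> /esym/(key _ _ tI sI st).
  + rewrite !c'2 ?ltW// => /addrI/eqP; rewrite -subr_eq0 -scalerBl scaler_eq0.
    rewrite [y - _ == 0]subr_eq0 [y == _]eq_sym (negbTE cy) orbF.
    by rewrite opprB addrA subrK subr_eq0 => /eqP.
- move=> t; rewrite in_itv /= => /andP[t1 t2]; case: (leP t t0) => tt0.
    by rewrite c'1//; apply: cS; apply: sub; rewrite in_itv /= t1.
  have [|s s01' ->] := c'E t; first by rewrite in_itv /= ltW.
  exact: xyS.
Qed.

Lemma chain_arc (h : nat -> 'rV[R]_n) (eps : R) i j : 0 <= eps -> (i <= j)%N ->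
  (forall l, (i <= l < j)%N -> `|h l - h l.+1| <= eps) ->
  arc_in [set x | exists2 l, (i <= l <= j)%N & `|x - h l| <= eps] (h i) (h j).
Proof.
move=> eps0; elim: j => [|j IH] ij hstep.
  move: ij; rewrite leqn0 => /eqP ->; exists 0, (fun=> h 0%N); split => //.
  - by move=> t; exact: cst_continuous.
  - move=> s t; rewrite !in_itv /= -!eq_le => /eqP <- /eqP <- //.
  - by move=> t _; exists 0%N => //; rewrite subrr normr0.
move: ij; rewrite leq_eqVlt => /orP[/eqP ->|ij].
  exists 0, (fun=> h j.+1); split => //.
  - by move=> t; exact: cst_continuous.
  - move=> s t; rewrite !in_itv /= -!eq_le => /eqP <- /eqP <- //.
  - by move=> t _; exists j.+1; rewrite ?leqnn// subrr normr0.
apply: (@arc_in_extend _ _ (h j)).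
  have [T [c [T0 cc cE cinj cS]]] : arc_in
      [set x | exists2 l, (i <= l <= j)%N & `|x - h l| <= eps] (h i) (h j).
    apply: IH => // l /andP[il lj]; apply: hstep; rewrite il ltnS ltnW//.
  exists T, c; split=> // t /cS[l /andP[il lj] hl].
  by exists l => //; rewrite il leqW.
move=> t; rewrite in_itv /= => /andP[t0 t1]; exists j.
  by rewrite -ltnS ij leqnSn.
have -> : line (h j) (h j.+1) t - h j = t *: (h j.+1 - h j).
  by rewrite /line addrC addKr.
rewrite normrZ ger0_norm// distrC -[leRHS]mul1r; apply: ler_pM => //.
by apply: hstep; rewrite -ltnS ij ltnS leqnn.
Qed.

(** Take a subchain with the fewest steps among those whose ends are more than [delta] apart. Its
    proper subchains have ends within [delta], and one more step costs [eps]. This keeps the arc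
    built on it shorter than 1 in diameter. *)
Lemma short_subchain (h : nat -> 'rV[R]_n) (delta eps : R) i j : (i <= j)%N ->
  (forall l, (i <= l < j)%N -> `|h l - h l.+1| <= eps) ->
  delta < `|h i - h j| -> 0 <= delta ->
  exists i' j', [/\ (i <= i' < j')%N, (j' <= j)%N, delta < `|h i' - h j'|
    & forall p q : nat, (i' <= p)%N -> (p <= q)%N -> (q <= j')%N ->
        `|h p - h q| <= delta + eps].
Proof.
have [m] := ubnP (j - i); elim: m i j => // m IH i j jim ij hstep hij d0.
have ltij : (i < j)%N.
  rewrite ltn_neqAle ij andbT; apply: contraTneq hij => ->.
  by rewrite subrr normr0 -leNgt.
have [[p [q [ip pq qj hpq neq]]]|none] := pselect (exists p q : nat,
    [/\ (i <= p)%N, (p <= q)%N, (q <= j)%N, delta < `|h p - h q|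
      & (q - p < j - i)%N]).
  have [||i' [j' [h1 h2 h3 h4]]] := IH p q _ pq _ hpq d0.
  - by rewrite (leq_trans neq)// -ltnS.
  - move=> l /andP[pl lq]; apply: hstep.
    by rewrite (leq_trans ip pl) (leq_trans lq qj).
  exists i', j'; split => //; last exact: leq_trans h2 qj.
  by move: h1 => /andP[pi' ->]; rewrite (leq_trans ip pi').
exists i, j; split=> //; first by rewrite leqnn ltij.
have small (p q : nat) : (i <= p)%N -> (p <= q)%N -> (q <= j)%N ->
    (q - p < j - i)%N ->
    `|h p - h q| <= delta.
  move=> ip pq qj qp; rewrite leNgt; apply/negP => hpq.
  by apply: none; exists p, q.
have eps0 : 0 <= eps by apply: le_trans (hstep i _); rewrite ?leqnn ?ltij.
move=> p q ip pq qj; case: (ltnP (q - p) (j - i)) => qp.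
  by rewrite (le_trans (small _ _ ip pq qj qp))// lerDl.
have [-> ->] : p = i /\ q = j by lia.
move: ltij hstep small {ij jim none pq qj qp hij}; case: j => // j ij hstep small.
apply: le_trans (ler_distD (h j) _ _) _; apply: lerD.
  by apply: small; lia.
by apply: hstep; lia.
Qed.

(* A chain that moves far must contain a free stretch with distant endpoints:
   otherwise all its visits are to one and the same [U k]. *)
Lemma free_subchain (I : Type) (U : I -> set 'rV[R]_n) (z : nat -> 'rV[R]_n) M
    (eps eta delta1 delta2 : R) :
  0 <= eps -> 0 <= eta -> 0 <= delta2 ->
  (forall l, (l < M)%N -> `|z l - z l.+1| <= eps) ->
  (forall k x y, U k x -> U k y -> `|x - y| <= 1) ->
  (forall k k' x y, k <> k' -> U k x -> U k' y -> delta1 <= `|x - y|) ->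
  delta2 + 2 * eps < delta1 - 2 * eta ->
  2 * delta2 + 2 * eps + 1 + 2 * eta < `|z 0 - z M| ->
  exists i j, [/\ (i <= j <= M)%N, delta2 <= `|z i - z j|
    & forall l, (i <= l <= j)%N -> forall k x, U k x -> eta < `|z l - x|].
Proof.
move=> eps0 eta0 d20 zstep Udiam Udist d12 zM.
apply: contrapT => none.
pose near k x := exists2 w, U k w & `|x - w| <= eta.
pose free x := forall k, ~ near k x.
have small i j : (i <= j)%N -> (j <= M)%N ->
    (forall l, (i <= l <= j)%N -> free (z l)) -> `|z i - z j| < delta2.
  move=> ij jM fr; rewrite ltNge; apply/negP => dij; apply: none.
  exists i, j; split; rewrite ?ij// => l lij k x Ukx.
  rewrite ltNge; apply/negP => zlx; apply: (fr l lij k).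
  by exists x.
have near_eq k x y : near k x -> near k y -> `|x - y| <= 1 + 2 * eta.
  move=> [w Uw xw] [w' Uw' yw']; have := Udiam _ _ _ Uw Uw'.
  have := ler_distD w x y; have := ler_distD w' w y.
  by rewrite [`|w' - y|]distrC; lra.
have near_neq k k' x y : k <> k' -> near k x -> near k' y ->
    delta1 - 2 * eta <= `|x - y|.
  move=> kk' [w Uw xw] [w' Uw' yw']; have := Udist _ _ _ _ kk' Uw Uw'.
  have := ler_distD x w w'; have := ler_distD y x w'.
  by rewrite [`|w - x|]distrC; lra.
have nfree x : ~ free x -> exists k, near k x.
  by move=> /existsNP[k /contrapT nk]; exists k.
(* [j0] is the first visit and [j] the last one so far. A visit to another [k] would come after a
   free stretch spanning almost [delta1 - 2 * eta], more than [small] allows. *)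
have inv m : (m <= M)%N -> (forall l, (l <= m)%N -> free (z l)) \/
    exists k, exists j0, exists j,
    [/\ (j <= m)%N, near k (z j0) & near k (z j)] /\
    (`|z 0 - z j0| <= delta2 + eps /\ forall l, (j < l <= m)%N -> free (z l)).
  elim: m => [_|m IH mM].
    have [fr|/nfree[k nk]] := pselect (free (z 0)).
      by left=> l; rewrite leqn0 => /eqP ->.
    right; exists k, 0%N, 0%N; split => //; split; last by move=> l; lia.
    by rewrite subrr normr0 addr_ge0.
  have step := zstep m mM.
  have [all_fr|[k [j0 [j [[jm nj0 nj] [h1 h2]]]]]] := IH (ltnW mM).
    have [fr|/nfree[k nk]] := pselect (free (z m.+1)).
      by left=> l; rewrite leq_eqVlt => /orP[/eqP ->|/all_fr].
    right; exists k, m.+1, m.+1; split; first by split.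
    split; last by move=> l; lia.
    apply: le_trans (ler_distD (z m) _ _) _; apply: lerD => //.
    by apply: ltW; apply: small; [|exact: ltnW|move=> l /andP[_ /all_fr]].
  right; have [fr|/nfree[k' nk']] := pselect (free (z m.+1)).
    exists k, j0, j; split; first by split => //; exact: leqW.
    split=> // l /andP[jl]; rewrite leq_eqVlt => /orP[/eqP ->//|lm].
    by apply: h2; rewrite jl.
  exists k', j0, m.+1; split; last by split => // l; lia.
  suff kk' : k = k' by rewrite -kk' in nk' *.
  apply: contrapT => kk'; have := near_neq _ _ _ _ kk' nj nk'.
  suff : `|z j - z m.+1| <= delta2 + 2 * eps by lra.
  move: jm; rewrite leq_eqVlt => /orP[/eqP ->|jm]; first by lra.
  have := small j.+1 m jm (ltnW mM) h2.
  have := zstep j (ltn_trans jm mM).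
  have := ler_distD (z j.+1) (z j) (z m.+1).
  have := ler_distD (z m) (z j.+1) (z m.+1).
  by lra.
have [all_fr|[k [j0 [j [[jM nj0 nj] [h1 h2]]]]]] := inv M (leqnn M).
  have all_fr' l : (0 <= l <= M)%N -> free (z l) by move=> /all_fr.
  by have := small 0%N M (leq0n M) (leqnn M) all_fr'; lra.
have := near_eq _ _ _ nj0 nj.
have := ler_distD (z j0) (z 0) (z M); have := ler_distD (z j) (z j0) (z M).
suff : `|z j - z M| <= eps + delta2 by lra.
move: jM; rewrite leq_eqVlt => /orP[/eqP ->|jM].
  by rewrite subrr normr0 addr_ge0.
have := small j.+1 M jM (leqnn M) h2.
have := zstep j jM; have := ler_distD (z j.+1) (z j) (z M); lra.
Qed.

Lemma chain_short_arc (h : nat -> 'rV[R]_n) (delta eps : R) i j :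
  0 <= delta -> 0 <= eps -> (i <= j)%N ->
  (forall l, (i <= l < j)%N -> `|h l - h l.+1| <= eps) ->
  delta < `|h i - h j| ->
  exists c : R -> 'rV[R]_n, [/\ continuous c, {in `[0, 1] &, injective c},
    forall t, t \in `[0, 1] -> exists2 l, (i <= l <= j)%N & `|c t - h l| <= eps,
    forall s t, s \in `[0, 1] -> t \in `[0, 1] -> `|c s - c t| <= delta + 3 * eps
    & delta < `|c 0 - c 1| ].
Proof.
move=> d0 eps0 ij hstep hij.
have [i' [j' [/andP[ii' ij'] jj' hij' hsmall]]] := short_subchain ij hstep hij d0.
have [|T [c [T0 cc [c0 cT] cinj cS]]] := @chain_arc h eps i' j' eps0 (ltnW ij').
  move=> l /andP[il lj]; apply: hstep.
  by rewrite (leq_trans ii' il) (leq_trans lj jj').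
have Tgt0 : 0 < T.
  rewrite lt_neqAle T0 andbT; apply: contraTneq hij' => TE.
  by rewrite -c0 -cT -TE subrr normr0 -leNgt.
have scale t : t \in `[0, 1] -> T * t \in `[0, T].
  rewrite !in_itv /= => /andP[t0 t1]; rewrite mulr_ge0//=.
  by rewrite -[leRHS]mulr1 ler_wpM2l.
exists (fun t => c (T * t)); split.
- move=> t; apply: (@continuous_comp _ _ _ (fun t => T * t) c); last exact: cc.
  exact: mulrl_continuous.
- by move=> s t /scale sT /scale tT /(cinj _ _ sT tT)/(mulfI (lt0r_neq0 Tgt0)).
- move=> t /scale/cS[l /andP[il lj] cl]; exists l => //.
  by rewrite (leq_trans ii' il) (leq_trans lj jj').
- move=> s t /scale/cS[l /andP[il lj] cl] /scale/cS[l' /andP[il' lj'] cl'].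
  have : `|h l - h l'| <= delta + eps.
    have [ll'|/ltnW ll'] := leqP l l'; first exact: hsmall.
    by rewrite distrC; apply: hsmall.
  have := ler_distD (h l) (c (T * s)) (c (T * t)).
  have := ler_distD (h l') (h l) (c (T * t)); rewrite [`|h l' - c _|]distrC; lra.
- by rewrite mulr0 mulr1 c0 cT.
Qed.

End Arcs.

(** * Perturbations and global inverses *)

Section Continuity.
Context (R : realType).

Lemma continuousP_dist (V W : normedModType R) (f : V -> W) :
  continuous f <-> forall x e, 0 < e -> exists2 r, 0 < r &
    forall y, `|y - x| < r -> `|f y - f x| < e.
Proof.
split=> [cf x e e0|H x].
  have /cvgrPdist_lt/(_ e e0)/nbhs_ballP[r /= r0 h] := cf x.
  exists r => // y yx; rewrite distrC; apply: h.
  by rewrite -ball_normE /= distrC.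
apply/cvgrPdist_lt => e e0; have [r r0 h] := H x e e0.
apply/nbhs_ballP; exists r => // y; rewrite -ball_normE /= => xy.
by rewrite distrC; apply: h; rewrite distrC.
Qed.

(** Only [x] is confined to [K], so points of a compact cube can be compared with points across its
    boundary. *)
Lemma compact_unif_continuous (V W : normedModType R) (f : V -> W) (K : set V) e :
  continuous f -> compact K -> 0 < e -> exists2 d, 0 < d &
    forall x y, K x -> `|y - x| < d -> `|f y - f x| < e.
Proof.
move=> /continuousP_dist cf /compact_near_coveringP Kc e0.
pose P d x := forall y, `|y - x| < d -> `|f y - f x| < e.
have : \forall d \near 0^'+, K `<=` P d.
  apply: Kc => x Kx; have [r r0 h] := cf x (e / 2) (divr_gt0 e0 (ltr0n _ 2)).
  exists (ball x (r / 2), [set d | 0 < d < r / 2]).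
    split=> /=; first by apply: nbhsx_ballx; rewrite divr_gt0.
    near=> d; apply/andP; split; first by near: d; exact: nbhs_right_gt.
    by near: d; apply: nbhs_right_lt; rewrite divr_gt0.
  move=> [x' d] /= [xx' /andP[d0 dr]] y yx'.
  move: xx'; rewrite -ball_normE /= distrC => x'x.
  have h1 : `|f x' - f x| < e / 2 by apply: h; lra.
  have h2 : `|f y - f x| < e / 2.
    by apply: h; have := ler_distD x' y x; lra.
  by have := ler_distD (f x) (f y) (f x'); rewrite [`|f x - f x'|]distrC; lra.
move=> nearP; near (0 : R)^'+ => d.
have d0 : 0 < d by near: d; exact: nbhs_right_gt.
exists d => // x y Kx; have : K `<=` P d by near: d.
by move=> /(_ x Kx y).
Unshelve. all: by end_near. Qed.

(** Every [M] beyond [M0] works, so that two curves can share one subdivision. *)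
Lemma subdivision (V : normedModType R) (c : R -> V) e : continuous c -> 0 < e ->
  exists M0 : nat, forall M l, (M0 < M)%N -> (l < M)%N ->
    `|c (l%:R / M%:R) - c (l.+1%:R / M%:R)| <= e.
Proof.
move=> cc e0.
have [d d0 h] := compact_unif_continuous cc (@segment_compact R 0 1) e0.
exists (Num.truncn d^-1) => M l dM lM; apply: ltW; rewrite distrC.
have M0 : 0 < M%:R :> R by rewrite ltr0n; lia.
apply: h.
  by rewrite /= in_itv /= divr_ge0//= ler_pdivrMr// mul1r ler_nat ltnW.
rewrite -mulrBl -natr1 addrAC subrr add0r mul1r ger0_norm ?invr_ge0 ?(ltW M0)//.
by rewrite invf_plt// -truncn_lt_nat// invr_ge0 ltW.
Qed.

Lemma locally_lipschitz_continuous (V W : normedModType R) (f : V -> W) (C rho : R) :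
  0 < rho -> (forall x y, `|y - x| <= rho -> `|f y - f x| <= C * `|y - x|) ->
  continuous f.
Proof.
move=> rho0 fC; apply/continuousP_dist => x e e0.
exists (Num.min rho (e / (`|C| + 1))).
  by rewrite lt_min rho0 divr_gt0// ltr_wpDl.
move=> y; rewrite lt_min => /andP[/ltW yx]; rewrite ltr_pdivlMr ?ltr_wpDl// => ye.
apply: le_lt_trans (fC _ _ yx) _; apply: le_lt_trans ye.
by rewrite mulrC ler_wpM2l// (le_trans (ler_norm C))// lerDl.
Qed.

End Continuity.

Section Perturbation.
Context (R : realType) (n : nat).
Implicit Types (F G : 'rV[R]_n -> 'rV[R]_n).

(** C^1 closeness without derivatives: [G - F] is bounded by [kappa] and [kappa]-Lipschitz. *)
Definition perturb F (kappa : R) G :=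
  (forall x, `|G x - F x| <= kappa) /\
  (forall x y, `|(G x - F x) - (G y - F y)| <= kappa * `|x - y|).

Lemma perturb_le F k k' G : k <= k' -> perturb F k G -> perturb F k' G.
Proof.
move=> kk' [h1 h2]; split=> [x|x y]; first exact: le_trans (h1 x) kk'.
by apply: le_trans (h2 x y) _; rewrite ler_wpM2r.
Qed.

Lemma perturb_id F k : 0 <= k -> perturb F k F.
Proof. by move=> k0; split=> [x|x y]; rewrite !subrr ?subr0 ?normr0 ?mulr_ge0. Qed.

Lemma strict_approx_perturb F L e rho k G :
  strict_approx F L e rho -> perturb F k G -> strict_approx G L (e + k) rho.
Proof.
move=> FL [_ GF] x y y' yx y'x; have := FL x y y' yx y'x; have := GF y y'.
have -> : G y - G y' - (y - y') *m L x =
    (G y - F y - (G y' - F y')) + (F y - F y' - (y - y') *m L x).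
  move: ((y - y') *m L x) => u; apply/rowP => i; rewrite !mxE; ring.
by have := ler_normD (G y - F y - (G y' - F y')) (F y - F y' - (y - y') *m L x); lra.
Qed.

Lemma perturb_continuous F k G : continuous F -> perturb F k G -> continuous G.
Proof.
move=> cF [_ GF].
have -> : G = fun x => (G x - F x) + F x by apply/funext => x; rewrite subrK.
have cGF : continuous (fun x => G x - F x).
  by apply: (@locally_lipschitz_continuous _ _ _ _ k 1) => // x y _; exact: GF.
move=> x; apply: (@continuousD R 'rV[R]_n 'rV[R]_n (fun x => G x - F x) F).
  exact: cGF.
exact: cF.
Qed.

End Perturbation.

Section GlobalInverse.
Context (R : realType) (n : nat).
Implicit Types (x y z v w : 'rV[R]_n).
Context (G : 'rV[R]_n -> 'rV[R]_n) (c rho : R).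
Hypotheses (c_gt0 : 0 < c) (rho_gt0 : 0 < rho).
Hypothesis Gsurj : forall x w (s : R), 0 <= s -> s <= rho -> `|w - G x| <= c * s ->
  exists2 y, `|y - x| <= s & G y = w.

(** The radius [c * rho] of local surjectivity is the same everywhere, so the segment from [G 0] to
    [w] can be lifted in finitely many steps. *)
Lemma global_surjectivity w : exists x, G x = w.
Proof.
have crho : 0 < c * rho by rewrite mulr_gt0.
have reach k : forall w, `|w - G 0| <= k%:R * (c * rho) -> exists x, G x = w.
  elim: k => [|k IH] {}w wk.
    exists 0; apply/esym/eqP; rewrite -subr_eq0 -normr_le0.
    by rewrite mul0r in wk.
  have k1 : 0 < k.+1%:R :> R by rewrite ltr0n.
  pose w' := G 0 + (k%:R / k.+1%:R) *: (w - G 0).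
  have [x Gx] : exists x, G x = w'.
    apply: IH; rewrite /w' addrC addKr normrZ ger0_norm ?divr_ge0//.
    rewrite -mulrA ler_wpM2l// mulrC ler_pdivrMr//.
    by rewrite [c * rho * _]mulrC.
  have [|y _ Gy] := @Gsurj x w rho (ltW rho_gt0) (lexx _).
  - rewrite Gx /w' (_ : w - _ = k.+1%:R^-1 *: (w - G 0)).
      by rewrite normrZ gtr0_norm ?invr_gt0// mulrC ler_pdivrMr// [c * rho * _]mulrC.
    have kE : k%:R = k.+1%:R - 1 :> R by rewrite -natr1 addrK.
    by apply/rowP => i; rewrite !mxE kE; field; rewrite gt_eqF.
  - by exists y.
apply: (reach (Num.truncn (`|w - G 0| / (c * rho))).+1).
by rewrite -ler_pdivrMr// ltW// truncnS_gt.
Qed.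

Lemma inverse_continuous (Ginv : 'rV[R]_n -> 'rV[R]_n) :
  injective G -> cancel Ginv G -> continuous Ginv.
Proof.
move=> Ginj GK.
have GinvK : cancel G Ginv by move=> x; apply: Ginj; rewrite GK.
have crho : 0 < c * rho by rewrite mulr_gt0.
apply: (@locally_lipschitz_continuous _ _ _ _ c^-1 (c * rho)) => // w w' ww'.
have [|||y yw Gy] := @Gsurj (Ginv w) w' (c^-1 * `|w' - w|).
- by rewrite mulr_ge0// invr_ge0 ltW.
- by rewrite ler_pdivrMl//.
- by rewrite GK mulrA divff ?mul1r// gt_eqF.
- by have -> : Ginv w' = y by rewrite -Gy GinvK.
Qed.

Lemma iter_surj K t : 0 < t -> exists2 s, 0 < s & forall x w,
  `|w - iter K G x| <= s -> exists2 y, `|y - x| <= t & iter K G y = w.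
Proof.
elim: K t => [|K IH] t t0; first by exists t => // x w wx; exists w.
have [s s0 h] := IH t t0; pose s1 := Num.min s rho.
have s10 : 0 < s1 by rewrite lt_min s0.
exists (c * s1); first by rewrite mulr_gt0.
move=> x w wx; have [|y yx Gy] := @Gsurj (iter K G x) w s1 (ltW s10) _ wx.
  by rewrite ge_min lexx orbT.
have [|u ux Gu] := h x y; first by rewrite (le_trans yx)// ge_min lexx.
by exists u => //=; rewrite Gu.
Qed.

End GlobalInverse.

(** * Shadowing *)

Section DistanceToSet.
Context (R : realType) (V : normedModType R).
Implicit Types (A : set V) (x y w : V).

Definition dist_to A y : R := inf [set `|y - w| | w in A].

Lemma dist_to_le A y w : A w -> dist_to A y <= `|y - w|.
Proof.
move=> Aw; apply: ge_inf; last by exists w.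
by exists 0 => _ [u _ <-].
Qed.

Lemma dist_to_lt A y t : A !=set0 -> dist_to A y < t ->
  exists2 w, A w & `|y - w| < t.
Proof.
move=> [w0 Aw0] yt.
have [||_ [w Aw <-] h] :=
  @inf_adherent R [set `|y - w| | w in A] (t - dist_to A y).
- by rewrite subr_gt0.
- split; first by exists `|y - w0|, w0.
  by exists 0 => _ [u _ <-].
by exists w => //; rewrite /dist_to in h; lra.
Qed.

Lemma dist_to_lipschitz A x y : A !=set0 -> dist_to A y <= dist_to A x + `|y - x|.
Proof.
move=> A0; apply/ler_addgt0Pr => e e0.
have [|w Aw xw] := @dist_to_lt A x (dist_to A x + e) A0; first by rewrite ltrDl.
have := dist_to_le y Aw; have := ler_distD x y w; lra.
Qed.

Lemma dist_to_continuous A : A !=set0 -> continuous (dist_to A).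
Proof.
move=> A0; apply: (@locally_lipschitz_continuous R V R _ 1 1) => // x y _.
have := dist_to_lipschitz x y A0; have := dist_to_lipschitz y x A0.
by rewrite [`|x - y|]distrC mul1r ler_norml; lra.
Qed.

End DistanceToSet.

Section Shadowing.
Context (R : realType) (n : nat).
Implicit Types (x y z v w : 'rV[R]_n) (s : R) (m j : nat).
Context (F G Finv : 'rV[R]_n -> 'rV[R]_n) (N : 'rV[R]_n -> R).
Context (A : set 'rV[R]_n) (bl bu lam c rho eta kappa : R).
Hypotheses (cG : continuous G) (cFinv : continuous Finv).
Hypotheses (FK : cancel Finv F) (Finj : injective F).
Hypotheses (ND : forall v w, N (v + w) <= N v + N w)
  (NZ : forall a v, N (a *: v) = `|a| * N v) (bl_gt0 : 0 < bl)
  (Nlb : forall v, bl * `|v| <= N v) (Nub : forall v, N v <= bu * `|v|).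
Hypotheses (lam_gt1 : 1 < lam) (c_gt0 : 0 < c) (eta_gt0 : 0 < eta).
Hypothesis Fexp : forall x y y', A x -> `|y - x| <= rho -> `|y' - x| <= rho ->
  lam * N (y - y') <= N (F y - F y').
Hypothesis Fsurj : forall x w s, 0 <= s -> s <= rho -> `|w - F x| <= c * s ->
  exists2 y, `|y - x| <= s & F y = w.
Hypotheses (A0 : A !=set0) (GF : forall x, `|G x - F x| <= kappa).
Hypotheses (kappa_le : bu * kappa <= (lam - 1) * bl * eta)
  (bu_ge0 : 0 <= bu) (bu_ge_bl : bl <= bu)
  (eta_rho : 3 * eta + lam * eta / c <= rho).

(** It is 1 within [2 * eta] of [A] and 0 beyond [3 * eta], a distance at which the expansion of [F]
    near a point of [A] still applies. *)
Definition cutoff y := Num.min 1 (Num.max 0 (3 - dist_to A y / eta)).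

Lemma cutoff_continuous : continuous cutoff.
Proof.
move=> y; apply: (@continuous_min R _ (fun=> 1)
  (fun y => Num.max 0 (3 - dist_to A y / eta))).
  exact: cst_continuous.
apply: (@continuous_max R _ (fun=> 0) (fun y => 3 - dist_to A y / eta)).
  exact: cst_continuous.
apply: (@continuousB R R _ (fun=> 3) (fun y => dist_to A y / eta)).
  exact: cst_continuous.
apply: (@continuousM R _ (dist_to A) (fun=> eta^-1)); last exact: cst_continuous.
exact: dist_to_continuous.
Qed.

Lemma cutoff_ge0 y : 0 <= cutoff y.
Proof. by rewrite le_min ler01 le_max lexx. Qed.

Lemma cutoff_le1 y : cutoff y <= 1.
Proof. by rewrite ge_min lexx. Qed.

Lemma cutoff1 y : dist_to A y <= 2 * eta -> cutoff y = 1.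
Proof.
move=> yA; apply/min_idPl; rewrite le_max; apply/orP; right.
have : dist_to A y / eta <= 2 by rewrite ler_pdivrMr.
lra.
Qed.

Lemma cutoff_neq0 y : cutoff y != 0 -> dist_to A y < 3 * eta.
Proof.
move=> y0; rewrite ltNge; apply: contra y0 => yA.
have : 3 <= dist_to A y / eta by rewrite ler_pdivlMr.
move=> h; rewrite /cutoff (_ : Num.max _ _ = 0); first by rewrite min_r.
by apply/max_idPl; lra.
Qed.

(* An approximate conjugacy: [F (shadow m.+1 y) = shadow m (G y)] wherever the
   cutoff is 1, while [shadow m] stays close to the identity. *)
Fixpoint shadow m y : 'rV[R]_n :=
  if m is m'.+1 then y + cutoff y *: (Finv (shadow m' (G y)) - y) else y.

Lemma shadow_continuous m : continuous (shadow m).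
Proof.
elim: m => [|m IH] y; first exact: cvg_id.
apply: (@continuousD R 'rV[R]_n _ id
  (fun y => cutoff y *: (Finv (shadow m (G y)) - y))).
  exact: cvg_id.
apply: (@continuousZ R 'rV[R]_n _ cutoff (fun y => Finv (shadow m (G y)) - y)).
  exact: cutoff_continuous.
apply: (@continuousB R 'rV[R]_n _ (fun y => Finv (shadow m (G y))) id);
  last exact: cvg_id.
apply: (@continuous_comp _ _ _ (fun y => shadow m (G y)) Finv); last exact: cFinv.
by apply: (@continuous_comp _ _ _ G (shadow m)); [exact: cG|exact: IH].
Qed.

(** The bound reproduces itself: replacing [G y] by [F y] adds at most [bu * kappa], which gives at
    most [lam * (bl * eta)], and [Finv] divides this by [lam] wherever the cutoff is nonzero.
    [Fsurj] and injectivity identify [Finv] with the local inverse branch near [y], to which the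
    expansion estimate applies. *)
Lemma shadow_close m y : N (shadow m y - y) <= bl * eta.
Proof.
have eta0 : 0 < eta by []. have bl0 : 0 < bl by []. have lam1 : 1 < lam by [].
have c0 : 0 < c by [].
have kle : bu * kappa <= (lam - 1) * bl * eta by [].
have erho : 3 * eta + lam * eta / c <= rho by [].
elim: m y => [|m IH] y /=.
  rewrite subrr; apply: le_trans (Nub 0) _.
  by rewrite normr0 mulr0 mulr_ge0// ltW.
rewrite addrC addKr NZ ger0_norm ?cutoff_ge0//.
have [->|/cutoff_neq0 yA] := eqVneq (cutoff y) 0.
  by rewrite mul0r mulr_ge0// ltW.
have N0 v : 0 <= N v by apply: le_trans (Nlb v); rewrite mulr_ge0// ltW.
rewrite -[leRHS]mul1r; apply: ler_pM; rewrite ?cutoff_ge0 ?cutoff_le1//.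
set u := shadow m (G y); set x1 := Finv u.
have Nu : N (u - F y) <= lam * (bl * eta).
  have -> : u - F y = (u - G y) + (G y - F y) by rewrite addrA subrK.
  apply: le_trans (ND _ _) _.
  have := IH (G y); have := Nub (G y - F y).
  have : bu * `|G y - F y| <= bu * kappa by rewrite ler_wpM2l.
  rewrite -/u; lra.
have uFy : `|u - F y| <= lam * eta.
  rewrite -(ler_pM2l bl0); apply: le_trans (Nlb _) _; lra.
have lec : 0 <= lam * eta / c by rewrite divr_ge0 ?mulr_ge0 ?ltW// (lt_trans ltr01).
have [||x xy Fx] := @Fsurj y u (lam * eta / c) lec.
- lra.
- by rewrite mulrC divfK// gt_eqF.
have xE : x = x1 by apply: Finj; rewrite Fx FK.
rewrite {}xE in xy Fx.
have [w Aw yw] := dist_to_lt A0 yA.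
have h1 : `|y - w| <= rho by lra.
have h2 : `|x1 - w| <= rho.
  by apply: le_trans (ler_distD y _ _) _; lra.
have := Fexp Aw h2 h1; rewrite Fx => h3.
by rewrite -(ler_pM2l (lt_trans ltr01 lam1)); apply: le_trans h3 Nu.
Qed.

Lemma shadow_norm m y : `|shadow m y - y| <= eta.
Proof.
by rewrite -(ler_pM2l bl_gt0); apply: le_trans (Nlb _) _; exact: shadow_close.
Qed.

Lemma shadow_iter m j z : (j <= m)%N ->
  (forall i, (i < j)%N -> dist_to A (iter i G z) <= 2 * eta) ->
  iter j F (shadow m z) = shadow (m - j) (iter j G z).
Proof.
elim: j => [|j IH] jm near; first by rewrite subn0.
rewrite iterS IH ?(ltnW jm)// => [|i ij]; last by apply: near; exact: leqW.
rewrite (_ : (m - j = (m - j.+1).+1)%N) /=; last by lia.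
by rewrite cutoff1 ?near// scale1r addrC subrK FK.
Qed.

(** A bootstrap. While the [G]-orbit of [z] stays within [2 * eta] of [A], the semiconjugacy holds,
    so the next point of this orbit is within [eta] of the [F]-orbit of [shadow m z], itself within
    [eta] of a point of [A] on the orbit of [y]. *)
Lemma shadow_orbit m y z : A z ->
  (forall j, (j <= m)%N -> `|iter j F y - iter j F (shadow m z)| <= eta) ->
  (forall j, (1 <= j)%N -> A (iter j F y)) ->
  forall j, (j <= m)%N -> dist_to A (iter j G z) <= 2 * eta.
Proof.
move=> Az yz yA j jm; have eta0 : 0 < eta by [].
elim/ltn_ind: j jm => -[_ _|j IH jm].
  by have := dist_to_le z Az; rewrite subrr normr0 /=; lra.
have h := shadow_iter jm (fun i ij => IH i ij (ltnW (leq_trans ij jm))).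
have := dist_to_le (iter j.+1 G z) (yA j.+1 isT).
have := yz _ jm; rewrite h; set a := iter j.+1 G z; set b := iter j.+1 F y.
have := shadow_norm (m - j.+1) a; set d := shadow _ _.
have := ler_distD d a b; rewrite [`|a - d|]distrC [`|d - b|]distrC.
by lra.
Qed.

End Shadowing.

(** * Iterates of balls *)

Section Core.
Context (R : realType) (n' : nat).
Local Notation n := n'.+1.
Local Notation V := 'rV[R]_n.
Implicit Types (x y z p q v w : V).
Context (N : V -> R) (A : set V) (bl bu : R).
Hypotheses (ND : forall v w, N (v + w) <= N v + N w)
  (NZ : forall (a : R) v, N (a *: v) = `|a| * N v) (bl_gt0 : 0 < bl)
  (Nlb : forall v, bl * `|v| <= N v) (Nub : forall v, N v <= bu * `|v|).
Hypotheses (bl_le_bu : bl <= bu) (A0 : A !=set0).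

Lemma approx_expansion (H : V -> V) (L : V -> 'M[R]_n) (e rho lam0 lam : R) :
  strict_approx H L e rho -> 0 <= e ->
  (forall x v, A x -> lam0 * N v <= N (v *m L x)) ->
  bu * e <= (lam0 - lam) * bl ->
  forall x y y', A x -> `|y - x| <= rho -> `|y' - x| <= rho ->
    lam * N (y - y') <= N (H y - H y').
Proof.
move=> HL e0 Lexp bue x y y' Ax yx y'x.
have bl0 : 0 < bl by []. have bu0 : 0 <= bu by apply: le_trans bl_le_bu; rewrite ltW.
set u := y - y'.
have NN v : N (- v) = N v by rewrite -scaleN1r NZ normrN1 mul1r.
have h1 : N (u *m L x) <= N (H y - H y') + N (H y - H y' - u *m L x).
  rewrite -[N (_ - u *m L x)]NN; apply: le_trans (ND _ _).
  by rewrite opprB addrC subrK.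
have h2 : N (H y - H y' - u *m L x) <= bu * (e * `|u|).
  by apply: le_trans (Nub _) _; rewrite ler_wpM2l//; exact: HL.
have h3 : bu * e * `|u| <= (lam0 - lam) * bl * `|u| by rewrite ler_wpM2r.
have lamp : 0 <= (lam0 - lam).
  have := le_trans (mulr_ge0 bu0 e0) bue; by rewrite pmulr_lge0.
have h4 : (lam0 - lam) * (bl * `|u|) <= (lam0 - lam) * N u.
  by rewrite ler_wpM2l.
have := Lexp x u Ax; lra.
Qed.

Section Expansion.
Context (G : V -> V) (c rho eta lam : R).
Hypotheses (c_gt0 : 0 < c) (rho_gt0 : 0 < rho) (lam_gt1 : 1 < lam).
Hypotheses (eta_gt0 : 0 < eta) (eta_rho : 8 * eta <= rho).
Hypothesis Gsurj : forall x w (s : R), 0 <= s -> s <= rho -> `|w - G x| <= c * s ->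
  exists2 y, `|y - x| <= s & G y = w.
Hypothesis Gexp : forall x y y', A x -> `|y - x| <= rho -> `|y' - x| <= rho ->
  lam * N (y - y') <= N (G y - G y').

(** The target is pulled back one step at a time. The second bound on [w] keeps it within reach of
    the local inverse, and is inherited by the preimages because each step back shrinks the
    [N]-distance to the orbit by [lam]. *)
Lemma ball_expansion z m (s : R) : 0 < s ->
  (forall j, (j < m)%N -> dist_to A (iter j G z) <= 2 * eta) ->
  forall w, N (w - iter m G z) <= lam ^+ m * s ->
    N (w - iter m G z) <= bl * (c * (rho / 2)) ->
    exists2 y, N (y - z) <= s & iter m G y = w.
Proof.
move=> s0; elim: m => [|m IH] near w.
  by rewrite expr0 mul1r => ws _; exists w.
rewrite iterS => w1 w2; set a := iter m G z in w1 w2 *.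
have rho0 : 0 < rho by []. have erho : 8 * eta <= rho by [].
have lam0 : 0 < lam by exact: lt_trans ltr01 lam_gt1.
have eta0 : 0 < eta by [].
have [|||y ya Gy] := @Gsurj a w (rho / 2).
- by rewrite divr_ge0// ltW.
- lra.
- by rewrite -(ler_pM2l bl_gt0); apply: le_trans (Nlb _) w2.
have [|u Au au] := @dist_to_lt _ _ A a (3 * eta) A0.
  by have := near m (ltnSn m); rewrite -/a; lra.
have Nya : lam * N (y - a) <= N (w - G a).
  by rewrite -Gy; apply: (Gexp Au); have := ler_distD a y u; lra.
have [|||v vz vy] := IH _ y.
- by move=> j jm; apply: near; exact: leqW.
- by rewrite -(ler_pM2l lam0); rewrite -/a mulrA -exprS (le_trans Nya).
- rewrite -/a; apply: le_trans (le_trans Nya w2); rewrite ler_peMl ?(ltW lam_gt1)//.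
  by apply: le_trans (Nlb _); rewrite mulr_ge0// ltW.
by exists v => //=; rewrite vy.
Qed.

End Expansion.

Context (F : V -> V) (L : V -> 'M[R]_n) (c0 C sigma lam0 : R).
Hypotheses (cF : continuous F) (c0_gt0 : 0 < c0) (C_ge0 : 0 <= C)
  (sigma_gt1 : 1 < sigma) (lam0_gt1 : 1 < lam0).
Hypothesis FL : forall e : R, 0 < e ->
  exists2 rho : R, 0 < rho & strict_approx F L e rho.
Hypothesis Lunit : forall x, L x \in unitmx.
Hypothesis Lge : forall x v, c0 * `|v| <= `|v *m L x|.
Hypothesis Lle : forall x v, `|v *m L x| <= C * `|v|.
Hypothesis Lsigma : forall x, sigma <= `|\det (L x)|.
Hypothesis Lexp : forall x v, A x -> lam0 * N v <= N (v *m L x).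

Context (I : Type) (U : I -> set V) (delta0 delta1 : R).
Hypothesis AE : forall x, (forall k, ~ U k x) -> A x.
Hypothesis Udiam : forall k x y, U k x -> U k y -> `|x - y| <= 1.
Hypothesis Udist : forall k k' x y, k <> k' -> U k x -> U k' y -> delta1 <= `|x - y|.
Hypotheses (delta0_gt0 : 0 < delta0) (delta01 : delta0 < delta1).
(* In the first case there is nothing to avoid, and [delta0] is arbitrary. *)
Hypothesis delta0_lt1 : (forall x, A x) \/ delta0 < 1.
Hypothesis harc : forall c : R -> V, continuous c -> {in `[0, 1] &, injective c} ->
  (forall s t, s \in `[0, 1] -> t \in `[0, 1] -> `|c s - c t| < 1) ->
  (forall t, t \in `[0, 1] -> A (c t)) -> delta0 < `|c 0 - c 1| ->
  exists2 t, t \in `[0, 1] & forall k, (1 <= k)%N -> A (iter k F (c t)).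

Lemma iterates_contain_ball : exists2 kappa : R, 0 < kappa &
  exists2 eps0 : R, 0 < eps0 & forall G, perturb F kappa G ->
    forall p (r : R), 0 < r -> exists K q, forall w, `|w - q| <= eps0 ->
      exists2 x, `|x - p| <= r & iter K G x = w.
Proof.
have bl0 : 0 < bl by []. have bu0 : 0 < bu by exact: lt_le_trans bl_le_bu.
have bu0' := ltW bu0.
have [t t0 tsigma] : exists2 t : R, 0 < t & (1 + t) ^+ n < sigma.
  have [||t t0 ht] := @pow_add1_le R n 1 ((1 + sigma) / 2); first by [].
    by have := sigma_gt1; lra.
  by exists t => //; have := sigma_gt1; lra.
pose lam := (1 + lam0) / 2.
have lam1 : 1 < lam by rewrite /lam; have := lam0_gt1; lra.
have lamlam0 : 0 < lam0 - lam by rewrite /lam; have := lam0_gt1; lra.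
pose c := c0 / 4; have c_gt0 : 0 < c by rewrite divr_gt0.
(* The bounds ensure local invertibility, expansion by [lam] in the norm [N], and volume growth
   despite the distortion [(1 + 8 * e / c0) ^+ n]. Half of [e] is left for the perturbation. *)
pose e := Num.min (c0 / 4) (Num.min ((lam0 - lam) * bl / bu) (t * c0 / 8)).
have e_gt0 : 0 < e by rewrite !lt_min c_gt0 !divr_gt0 ?mulr_gt0.
have ec0 : e <= c0 / 4 by rewrite ge_min lexx.
have ebu : bu * e <= (lam0 - lam) * bl.
  by rewrite mulrC -ler_pdivlMr// /e !ge_min lexx !orbT.
have et : 8 * e / c0 <= t.
  have : e <= t * c0 / 8 by rewrite /e !ge_min lexx !orbT.
  by rewrite ler_pdivrMr//; lra.
have eq_sigma : (1 + 8 * e / c0) ^+ n < sigma.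
  apply: le_lt_trans tsigma; apply: lerXn2r; rewrite ?nnegrE.
  - by rewrite addr_ge0// divr_ge0 ?mulr_ge0// ltW.
  - by rewrite addr_ge0// ltW.
  - by rewrite lerD2l.
have [|rho rho0 FLe] := FL (_ : 0 < e / 2); first by rewrite divr_gt0.
(* The four bounds serve, in order, the shadowing estimate, the gap between the sets [U k], the
   length required by [free_subchain], and [ball_expansion]. *)
pose eta := Num.min (rho / (3 + lam / c)) (Num.min ((delta1 - delta0) / 20)
  (Num.min (1 / 20) (rho / 8))).
have lc0 : 0 < lam / c by rewrite divr_gt0// (lt_trans ltr01).
have eta0 : 0 < eta.
  by rewrite !lt_min !divr_gt0 ?subr_gt0// ltr_wpDl ?ltW.
have eta1 : 3 * eta + lam * eta / c <= rho.
  have -> : 3 * eta + lam * eta / c = eta * (3 + lam / c) by ring.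
  rewrite -ler_pdivlMr; last by rewrite ltr_wpDl ?ltW.
  by rewrite /eta !ge_min lexx.
have eta2 : 20 * eta <= delta1 - delta0.
  by rewrite mulrC -ler_pdivlMr// /eta !ge_min lexx !orbT.
have eta3 : 20 * eta <= 1.
  by rewrite mulrC -ler_pdivlMr// /eta !ge_min lexx !orbT.
have eta4 : 8 * eta <= rho.
  by rewrite mulrC -ler_pdivlMr// /eta !ge_min lexx !orbT.
pose kappa := Num.min (e / 2) ((lam - 1) * bl * eta / bu).
have kappa0 : 0 < kappa.
  by rewrite lt_min !divr_gt0 ?mulr_gt0// subr_gt0.
have kappa1 : kappa <= e / 2 by rewrite ge_min lexx.
have kappa2 : bu * kappa <= (lam - 1) * bl * eta.
  by rewrite mulrC -ler_pdivlMr// /kappa ge_min lexx orbT.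
(* The largest radius that [ball_expansion] can reach; it involves neither [G] nor the ball around
   [p]. *)
pose s0 := bl * (c * (rho / 2)).
have s00 : 0 < s0 by rewrite !mulr_gt0// divr_gt0.
exists kappa => //; exists (s0 / bu); first by rewrite divr_gt0.
move=> G PG p r r_gt0.
have approx H : perturb F kappa H -> strict_approx H L e rho.
  move=> /(perturb_le kappa1)/(strict_approx_perturb FLe) h x y y' yx y'x.
  by have := h x y y' yx y'x; rewrite -splitr.
have approxF := approx F (perturb_id F (ltW kappa0)).
have approxG := approx G PG.
have cG := perturb_continuous cF PG.
have Fsurj := local_surjection cF c0_gt0 ec0 approxF Lunit Lge.
have Gsurj := local_surjection cG c0_gt0 ec0 approxG Lunit Lge.
have Finj := global_injectivity cF c0_gt0 ec0 approxF Lunit Lge rho0 (ltW e_gt0)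
  C_ge0 Lle.
have Ginj := global_injectivity cG c0_gt0 ec0 approxG Lunit Lge rho0 (ltW e_gt0)
  C_ge0 Lle.
have Fexp := approx_expansion approxF (ltW e_gt0) Lexp ebu.
have Gexp := approx_expansion approxG (ltW e_gt0) Lexp ebu.
have /choice[Finv FK] := global_surjectivity c_gt0 rho0 Fsurj.
have cFinv := inverse_continuous c_gt0 rho0 Fsurj Finj FK.
(* [K] does not depend on the length [m] of the orbit segment to be followed: the
   ball around [iter K G x] must be fixed before [m] is chosen large enough to
   expand it to the size [s0]. *)
suff [K follow] : exists K, forall m, exists2 x, `|x - p| <= r / 2 &
    forall j, (j <= m)%N -> dist_to A (iter (j + K) G x) <= 2 * eta.
  have r2 : 0 < r / 2 by rewrite divr_gt0.
  have [s s_gt0 hs] := iter_surj c_gt0 rho0 Gsurj K r2.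
  have [m sm] : exists m, s0 <= lam ^+ m * (bl * s).
    have bls : 0 < bl * s / s0 by rewrite divr_gt0// mulr_gt0.
    have lamV : `|lam^-1| < 1.
      by rewrite ger0_norm ?invf_lt1// ?invr_ge0 ?ltW// (lt_trans ltr01).
    have /cvgrPdist_lt/(_ _ bls)[m _ /(_ m (leqnn m))] /= := cvg_expr lamV.
    have lamm : 0 < lam ^+ m by rewrite exprn_gt0// (lt_trans ltr01).
    rewrite sub0r normrN exprVn ger0_norm ?invr_ge0 ?ltW// => h; exists m.
    by rewrite -ler_pdivrMl// -ler_pdivlMr// ltW.
  have [x xp near] := follow m.
  exists (m + K)%N, (iter m G (iter K G x)) => w wq.
  have Nw : N (w - iter m G (iter K G x)) <= s0.
    by apply: le_trans (Nub _) _; rewrite mulrC -ler_pdivlMr.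
  have [||||y yz Gy] := @ball_expansion G c rho eta lam rho0 lam1 eta0 eta4 Gsurj
    Gexp (iter K G x) m (bl * s) _ _ w.
  - by rewrite mulr_gt0.
  - by move=> j jm; rewrite -iterD; apply: near; exact: ltnW.
  - exact: le_trans sm.
  - exact: Nw.
  have [|u ux Gu] := hs x y.
    by rewrite -(ler_pM2l bl_gt0); apply: le_trans (Nlb _) yz.
  exists u; last by rewrite iterD Gu.
  by have := ler_distD x u p; lra.
have [allA|d01] := delta0_lt1.
  exists 0%N => m; exists p; first by rewrite subrr normr0 divr_ge0// ltW.
  move=> j _; set q := iter _ G p; apply: le_trans (dist_to_le q (allA q)) _.
  by rewrite subrr normr0 mulr_ge0// ltW.
have r2 : 0 < r / 2 by rewrite divr_gt0.
have sigma0 : 0 < sigma by exact: lt_trans sigma_gt1.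
(* The length 10 exceeds [2 * (delta0 + 3 * eta) + 2 * eps + 1 + 8 * eta], which is below 4 for the
   [eps] chosen later. *)
have [K [x0 [y0 [x0p y0p far]]]] :=
  iterates_grow cG c0_gt0 ec0 rho0 (ltW e_gt0) approxG Lunit Lge Ginj sigma0 Lsigma
    eq_sigma p r2 (ltr0n _ 10).
exists K => m.
pose h := shadow G Finv A eta m.
have ch : continuous h by exact: shadow_continuous.
pose B := Num.max 1 (C + e).
have B1 : 1 <= B by rewrite le_max lexx.
have Fiter j x y : B ^+ j * `|x - y| <= rho ->
    `|iter j F x - iter j F y| <= B ^+ j * `|x - y|.
  elim: j => [|j IH] hj; first by rewrite expr0 mul1r.
  have B0 : 0 <= B ^+ j * `|x - y| by rewrite mulr_ge0 ?exprn_ge0// (le_trans ler01).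
  have hj' : B ^+ j * `|x - y| <= rho.
    by apply: le_trans hj; rewrite exprS -mulrA ler_peMl.
  have {}IH := IH hj'; set a := iter j F x in IH *; set b := iter j F y in IH *.
  have aa : `|a - a| <= rho by rewrite subrr normr0 ltW.
  have ba : `|b - a| <= rho by rewrite distrC; apply: le_trans IH hj'.
  rewrite exprS -mulrA /=.
  apply: le_trans (local_lipschitz approxF Lle aa ba) _.
  apply: ler_pM => //; first by rewrite addr_ge0// ltW.
  by rewrite le_max lexx orbT.
(* An error [eps] grows to at most [eta] in [m] steps of [F], and an arc of diameter at most
   [delta0 + 3 * eps] stays below diameter 1. *)
pose eps := Num.min (eta / B ^+ m) ((1 - delta0) / 6).
have Bm : 0 < B ^+ m by rewrite exprn_gt0// (lt_le_trans ltr01).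
have eps0 : 0 < eps by rewrite lt_min !divr_gt0// subr_gt0.
have eps1 : B ^+ m * eps <= eta by rewrite mulrC -ler_pdivlMr// ge_min lexx.
have eps2 : 6 * eps <= 1 - delta0.
  by rewrite mulrC -ler_pdivlMr// ge_min lexx orbT.
have eps3 : eps <= eta.
  by apply: le_trans eps1; rewrite ler_peMl ?(ltW eps0)// exprn_ege1.
pose cc u := iter K G (line x0 y0 u).
have cK k : continuous (fun u => iter k G (line x0 y0 u)).
  elim: k => [|k IH] u; first exact: line_continuous.
  apply: (@continuous_comp _ _ _ (fun u => iter k G (line x0 y0 u)) G).
    exact: IH.
  exact: cG.
have ccc : continuous cc by exact: cK.
have chc : continuous (fun u => h (cc u)).
  by move=> u; apply: (@continuous_comp _ _ _ cc h); [exact: ccc|exact: ch].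
have [M1 hM1] := subdivision ccc eps0.
have [M2 hM2] := subdivision chc eps0.
pose M := (maxn M1 M2).+1.
have M1M : (M1 < M)%N by rewrite ltnS leq_maxl.
have M2M : (M2 < M)%N by rewrite ltnS leq_maxr.
pose z l := cc (l%:R / M%:R).
have delta0_0 : 0 < delta0 by [].
have z0E : z 0%N = iter K G x0 by rewrite /z /cc mul0r /line scale0r addr0.
have zME : z M = iter K G y0.
  by rewrite /z /cc divff ?pnatr_eq0// /line scale1r addrC subrK.
(* The extra [3 * eta] leaves more than [delta0] after [h] has moved both ends by at most [eta]. The
   clearance [4 * eta] keeps in [A] the arc built below, which lies within [2 * eta] of the points
   of the stretch. *)
have [||||||||i [j [/andP[ij jM] dij free]]] :=
  @free_subchain R n I U z M eps (4 * eta) delta1 (delta0 + 3 * eta).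
- exact: ltW.
- by rewrite mulr_ge0// ltW.
- by rewrite addr_ge0 ?mulr_ge0 ?ltW.
- by move=> l; exact: hM1.
- exact: Udiam.
- exact: Udist.
- lra.
- by rewrite z0E zME; lra.
have hz l : `|h (z l) - z l| <= eta.
  apply: (@shadow_norm R n F G Finv N A bl bu lam c rho eta kappa) => //.
  exact: PG.1.
have dh : delta0 < `|h (z i) - h (z j)|.
  have := ler_distD (h (z i)) (z i) (z j).
  have := ler_distD (h (z j)) (h (z i)) (z j).
  have := hz i; have := hz j; rewrite [`|z i - h _|]distrC; lra.
have [|c' [cc' c'inj c'z c'd c'01]] := @chain_short_arc R n (fun l => h (z l))
  delta0 eps i j (ltW delta0_gt0) (ltW eps0) ij _ dh.
  by move=> l /andP[_ lj]; apply: hM2 => //; exact: leq_trans lj jM.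
have zA l x : (i <= l <= j)%N -> `|x - z l| <= 4 * eta -> A x.
  move=> lij xz; apply: AE => k Ukx; have := free l lij k x Ukx.
  by rewrite distrC; lra.
have [||u u01 c'uA] := harc cc' c'inj _ _ c'01.
- by move=> s t' s01 t01; apply: le_lt_trans (c'd _ _ s01 t01) _; lra.
- move=> s /c'z[l lij hl]; apply: (zA l) => //.
  by have := ler_distD (h (z l)) (c' s) (z l); have := hz l; lra.
have [l lij hl] := c'z u u01.
exists (line x0 y0 (l%:R / M%:R)).
  set u' := _ / _; have u'0 : 0 <= u' by rewrite divr_ge0.
  have u'1 : 0 <= 1 - u'.
    rewrite subr_ge0 ler_pdivrMr ?ltr0n// mul1r ler_nat.
    by move: lij => /andP[_ lj]; apply: leq_trans lj jM.
  clearbody u'.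
  have -> : line x0 y0 u' - p = (1 - u') *: (x0 - p) + u' *: (y0 - p).
    by rewrite /line; apply/rowP => k; rewrite !mxE; ring.
  apply: le_trans (ler_normD _ _) _; rewrite !normrZ !ger0_norm//.
  have := ler_wpM2l u'1 x0p; have := ler_wpM2l u'0 y0p; lra.
move=> j' j'm; rewrite iterD -/(cc _) -/(z l).
apply: (@shadow_orbit R n F G Finv N A bl bu lam c rho eta kappa FK Finj ND NZ bl0
  Nlb Nub lam1 c_gt0 eta0 Fexp Fsurj A0 PG.1 kappa2 bu0' bl_le_bu eta1 m (c' u)) => //.
- by apply: (zA l) => //; rewrite subrr normr0 mulr_ge0// ltW.
- move=> k km; rewrite -/h.
  have Bk : B ^+ k <= B ^+ m by apply: ler_weXn2l.
  have small : B ^+ k * `|c' u - h (z l)| <= eta.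
    apply: le_trans eps1; apply: ler_pM => //.
    by rewrite exprn_ge0// (le_trans ler01).
  by rewrite (le_trans _ small)// Fiter// (le_trans small)//; lra.
Qed.

End Core.

(** * Robustness of the density of preorbits at a fixed scale *)

Section RobustDensity.
Context (R : realType) (n : nat).
Local Notation V := 'rV[R]_n.
Implicit Types (x y z p q v w : V) (F G : V -> V).

Lemma floor_cube (a x : V) : exists2 k : V, k \is a mxOver Num.int &
  forall i, a 0 i <= (x - k) 0 i <= a 0 i + 1.
Proof.
exists (\row_i (Num.floor (x 0 i - a 0 i))%:~R).
  by apply/mxOverP => i j; rewrite mxE intr_int.
move=> i; rewrite !mxE; have := floor_itv (x 0 i - a 0 i).
rewrite intrD => /andP[]; set k := (Num.floor _)%:~R => h1 h2.
by apply/andP; split; lra.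
Qed.

Lemma lattD x y : x \is a mxOver Num.int -> y \is a mxOver Num.int ->
  x + y \is a mxOver Num.int.
Proof.
move=> /mxOverP xZ /mxOverP yZ; apply/mxOverP => i j.
by rewrite mxE rpredD.
Qed.

Lemma lattB x y : x \is a mxOver Num.int -> y \is a mxOver Num.int ->
  x - y \is a mxOver Num.int.
Proof.
move=> /mxOverP xZ /mxOverP yZ; apply/mxOverP => i j.
by rewrite !mxE rpredB.
Qed.

Lemma lattN x : x \is a mxOver Num.int -> - x \is a mxOver Num.int.
Proof. by move=> /mxOverP xZ; apply/mxOverP => i j; rewrite mxE rpredN. Qed.

Definition lattice_map G := forall x y,
  x - y \is a mxOver Num.int -> G x - G y \is a mxOver Num.int.

Lemma lattice_map_iter G k : lattice_map G -> lattice_map (iter k G).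
Proof. by move=> Gl; elim: k => //= k IH x y /IH/Gl. Qed.

Lemma perturb_near F G (kappa c rho : R) x w (s : R) :
  (forall x w (s : R), 0 <= s -> s <= rho -> `|w - G x| <= c * s ->
    exists2 y, `|y - x| <= s & G y = w) ->
  perturb F kappa G -> 0 <= s -> s <= rho ->
  `|w - F x| + kappa <= c * s -> exists2 y, `|y - x| <= s & G y = w.
Proof.
move=> Gsurj [GF _] s0 srho h; apply: Gsurj => //; apply: le_trans h.
have := ler_distD (F x) w (G x); have := GF x.
by rewrite [`|F x - _|]distrC; lra.
Qed.

Context (F : V -> V) (c rho kappa0 : R).
Hypotheses (c_gt0 : 0 < c) (rho_gt0 : 0 < rho) (kappa0_gt0 : 0 < kappa0).
Hypothesis Gsurj : forall G, perturb F kappa0 G ->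
  forall x w (s : R), 0 <= s -> s <= rho -> `|w - G x| <= c * s ->
    exists2 y, `|y - x| <= s & G y = w.

(** The scale [s] is the same for all [G], and the ball of attained values is centred at the
    [F]-iterate, which does not depend on [G]. *)
Lemma robust_iter_open k w (t : R) : 0 < t -> exists2 s : R, 0 < s &
  forall G, perturb F s G -> forall v, `|v - iter k F w| <= s ->
    exists2 y, `|y - w| <= t & iter k G y = v.
Proof.
move=> t0; elim: k => [|k [s s0 IH]]; first by exists t => // G _ v vw; exists v.
pose s1 := Num.min s rho.
have s10 : 0 < s1 by rewrite lt_min s0.
pose s2 := Num.min (Num.min s kappa0) (c * s1 / 2).
have s20 : 0 < s2 by rewrite !lt_min s0 kappa0_gt0 divr_gt0// mulr_gt0.
exists s2 => // G PG v vw.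
have PG0 : perturb F kappa0 G by apply: perturb_le PG; rewrite /s2 !ge_min lexx orbT.
have PGs : perturb F s G by apply: perturb_le PG; rewrite /s2 !ge_min lexx.
have s2c : s2 <= c * s1 / 2 by rewrite /s2 ge_min lexx orbT.
have [||y1 y1s Gy1] := perturb_near (Gsurj PG0) PG (ltW s10) _
  (_ : `|v - F (iter k F w)| + s2 <= c * s1).
- by rewrite ge_min lexx orbT.
- by have : `|v - F (iter k F w)| <= s2 by []; lra.
have [|y yw Gy] := IH G PGs y1; first by rewrite (le_trans y1s)// ge_min lexx.
by exists y => //=; rewrite Gy.
Qed.

Hypothesis Fdense : forall q x (e : R), 0 < e -> exists w k,
  `|w - q| < e /\ iter k F w - x \is a mxOver Num.int.

(** One finite [F]-orbit segment handles a pair [(q, x)]; by openness of the iterates it also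
    handles nearby pairs and all nearby [G]. Compactness of the product of two unit cubes gives a
    common [kappa], and periodicity extends it to all pairs. *)
Lemma robust_density (e : R) : 0 < e -> exists2 kappa : R, 0 < kappa &
  forall G, perturb F kappa G -> lattice_map G -> forall q x,
    exists w k, `|w - q| <= e /\ iter k G w - x \is a mxOver Num.int.
Proof.
move=> e0; have e3 : 0 < e / 3 by rewrite divr_gt0.
pose P (kappa : R) (z : V * V) := forall G, perturb F kappa G ->
  exists w k, `|w - z.1| <= e /\ iter k G w - z.2 \is a mxOver Num.int.
pose cube : set V := [set v | forall i, v 0 i \in `[0, 1]].
have cubeK : compact cube.
  by apply: (@rV_compact R n (fun=> [set` `[0, 1]])) => _; exact: segment_compact.
have : \forall kappa \near 0^'+, cube `*` cube `<=` P kappa.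
  have /compact_near_coveringP := compact_setX cubeK cubeK.
  apply => -[q x] _.
  have [w [k [wq wx]]] := Fdense q x e3.
  have [s s0 hs] := robust_iter_open k w e3.
  pose r := Num.min s (e / 3).
  have r0 : 0 < r by rewrite lt_min s0.
  exists (ball (q, x) r, [set kappa | 0 < kappa < r]).
    split=> /=; first exact: nbhsx_ballx.
    near=> kappa; apply/andP; split; first by near: kappa; exact: nbhs_right_gt.
    by near: kappa; exact: nbhs_right_lt.
  move=> [[q' x'] kappa] /= [[]]; rewrite -!ball_normE /= => qq' xx' /andP[_ kr] G PG.
  have PGs : perturb F s G.
    by apply: perturb_le PG; rewrite (le_trans (ltW kr))// ge_min lexx.
  have [|y yw Gy] := hs G PGs (iter k F w + (x' - x)).
    rewrite addrC addKr distrC (le_trans (ltW xx'))// ge_min lexx//.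
  exists y, k; split.
    have re : r <= e / 3 by rewrite ge_min lexx orbT.
    have := ler_distD w y q'; have := ler_distD q w q'; lra.
  rewrite (_ : _ - _ = iter k F w - x) // Gy /=.
  by apply/rowP => i; rewrite !mxE; ring.
move=> nearP; near (0 : R)^'+ => kappa.
exists kappa; first by near: kappa; exact: nbhs_right_gt.
move=> G PG Gl q x.
have [kq kqZ kq01] := floor_cube 0 q; have [kx kxZ kx01] := floor_cube 0 x.
have Pk : cube `*` cube `<=` P kappa by near: kappa.
have [|w [k [wq wx]]] := Pk (q - kq, x - kx) _ G PG.
  split=> i /=; rewrite in_itv /=.
    by have := kq01 i; rewrite mxE add0r.
  by have := kx01 i; rewrite mxE add0r.
exists (w + kq), k; split; first by move: wq => /=; rewrite opprB addrA.
have h : iter k G (w + kq) - iter k G w \is a mxOver Num.int.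
  by apply: lattice_map_iter => //; rewrite addrC addKr.
have -> : iter k G (w + kq) - x =
    (iter k G (w + kq) - iter k G w) + (iter k G w - (x - kx)) - kx.
  by apply/rowP => i; rewrite !mxE; ring.
by apply: lattB => //; exact: lattD.
Unshelve. all: by end_near. Qed.

End RobustDensity.

(** * Maps with periodic derivative *)

Section MeanValue.
Context (R : realType) (n : nat).
Local Notation V := 'rV[R]_n.
Implicit Types (x y z v w : V) (M : 'M[R]_n) (H : V -> V).

Lemma mulmx_norm_le v M (B : R) : (forall i, `|row i M| <= B) ->
  `|v *m M| <= n%:R * B * `|v|.
Proof.
move=> MB; rewrite mulmx_sum_row; apply: le_trans (ler_norm_sum _ _ _) _.
apply: (@le_trans _ _ (\sum_(i < n) B * `|v|)); last first.
  by rewrite sumr_const card_ord -[leLHS]mulr_natl mulrA.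
apply: ler_sum => i _; rewrite normrZ mulrC; apply: ler_pM => //.
exact: coord_le_norm.
Qed.

Lemma row_jacobian H x i : differentiable H x ->
  row i (jacobian H x) = 'D_(delta_mx 0 i) H x.
Proof. by move=> dH; rewrite deriveEjacobian// rowE. Qed.

Lemma is_derive_line H x v (t : R) j : differentiable H (x + t *: v) ->
  is_derive t 1 (fun s : R => H (x + s *: v) 0 j) (('D_v H (x + t *: v)) 0 j).
Proof.
move=> dH; have dv := diff_derivable dH (v := v).
have /derivable_mxP/(_ 0 j) dj : derivable H (x + t *: v) v by apply: diff_derivable.
have E : (fun h : R => h^-1 *: ((fun s => H (x + s *: v) 0 j) (h *: 1 + t) -
      H (x + t *: v) 0 j)) =
    (fun h : R => h^-1 *: (((fun z => H z 0 j) \o shift (x + t *: v)) (h *: v) -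
      H (x + t *: v) 0 j)).
  apply/funext => h /=; congr (_ *: (H _ 0 j - _)).
  rewrite [h%:A]mulr1.
  by apply/rowP => i; rewrite !mxE; ring.
split; first by rewrite /derivable /= E.
rewrite (_ : ('D_v H _) 0 j = 'D_v (fun z => H z 0 j) (x + t *: v)).
  by rewrite /derive /= E.
by rewrite derive_mx ?mxE//; exact: diff_derivable.
Qed.

(** Stated per coordinate because the intermediate [t] depends on [j]; for the maximum norm this is
    enough. *)
Lemma mean_value_line H x y j : (forall z, differentiable H z) ->
  exists2 t : R, t \in `[0, 1] &
    (H y - H x) 0 j = ((y - x) *m jacobian H (x + t *: (y - x))) 0 j.
Proof.
move=> dH; pose f (t : R) : R := H (x + t *: (y - x)) 0 j.
pose df (t : R) : R := ('D_(y - x) H (x + t *: (y - x))) 0 j.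
have fdf t : is_derive (t : R) (1 : R) f (df t) by exact: is_derive_line.
have [|t t01 E] := @MVT_segment R f df 0 1 ler01 (fun t _ => fdf t).
  apply: continuous_subspaceT => t; apply: differentiable_continuous.
  by apply/derivable1_diffP; have [] := fdf t.
exists t => //; move: E; rewrite subr0 mulr1 /f /df scale0r addr0 scale1r.
by rewrite [x + (y - x)]addrC subrK deriveEjacobian// => <-; rewrite !mxE.
Qed.

Lemma jacobian_approx H M x (r e : R) :
  (forall z, differentiable H z) ->
  (forall z, `|z - x| <= r -> forall i, `|'D_(delta_mx 0 i) H z - row i M| <= e) ->
  forall y y', `|y - x| <= r -> `|y' - x| <= r ->
    `|H y - H y' - (y - y') *m M| <= n%:R * e * `|y - y'|.
Proof.
move=> dH He y y' yx y'x.
have r0 : 0 <= r by apply: le_trans yx.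
have e0 (i : 'I_n) : 0 <= e.
  by apply: le_trans (normr_ge0 _) (He x _ i); rewrite subrr normr0.
have ne0 : 0 <= n%:R * e.
  have [n0|n0] := posnP n; last by rewrite mulr_ge0// (e0 (Ordinal n0)).
  by rewrite (_ : n%:R = 0 :> R) ?mul0r// n0.
clear e0; apply: rV_norm_le => [|j]; first by rewrite mulr_ge0.
have [t t01 E] := mean_value_line y' y j dH.
set z := y' + t *: (y - y') in E.
have zx : `|z - x| <= r.
  have -> : z - x = (1 - t) *: (y' - x) + t *: (y - x).
    by rewrite /z; apply/rowP => k; rewrite !mxE; ring.
  move: t01; rewrite in_itv /= => /andP[t0 t1].
  apply: le_trans (ler_normD _ _) _; rewrite !normrZ !ger0_norm ?subr_ge0//.
  have h1 : (1 - t) * `|y' - x| <= (1 - t) * r by rewrite ler_wpM2l// subr_ge0.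
  have h2 : t * `|y - x| <= t * r by rewrite ler_wpM2l.
  lra.
have -> : (H y - H y' - (y - y') *m M) 0 j =
    ((y - y') *m (jacobian H z - M)) 0 j.
  rewrite mulmxBr [RHS]mxE -E; move: ((y - y') *m M) => u.
  by rewrite !mxE.
apply: le_trans (coord_le_norm _ _) _; apply: mulmx_norm_le => i.
by rewrite linearB /= row_jacobian//; exact: He.
Qed.

Lemma lipschitz_partials H (e : R) : (forall z, differentiable H z) ->
  (forall z i, `|'D_(delta_mx 0 i) H z| <= e) ->
  forall y y', `|H y - H y'| <= n%:R * e * `|y - y'|.
Proof.
move=> dH He y y'.
have := @jacobian_approx H 0 y (`|y' - y|) e dH _ y y'.
rewrite mulmx0 subr0 subrr normr0 lexx normr_ge0; apply => // z _ i.
by rewrite linear0 subr0.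
Qed.

Lemma mulmx_norm_bound M : exists2 B : R, 0 < B & forall v, `|v *m M| <= B * `|v|.
Proof.
pose B := \big[Num.max/0]_i `|row i M|.
have B0 : 0 <= B by rewrite /B; elim/big_ind : _ => // x y x0 y0; rewrite le_max x0.
exists (n%:R * B + 1); first by rewrite ltr_wpDl// mulr_ge0.
move=> v; have := @mulmx_norm_le v M B (fun i => le_bigmax _ _ i).
by move=> h; apply: le_trans h _; rewrite ler_wpM2r// lerDl.
Qed.

End MeanValue.

Section PeriodicDerivative.
Context (R : realType) (n : nat).
Local Notation V := 'rV[R]_n.
Implicit Types (x y z v w k : V).

Lemma lattice_lt1_eq0 k : k \is a mxOver Num.int -> `|k| < 1 -> k = 0.
Proof.
move=> /mxOverP kZ k1; apply/rowP => i; rewrite mxE; apply/eqP.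
apply: contraTT k1 => ki; rewrite -leNgt; apply: le_trans (coord_le_norm _ i).
exact: norm_intr_ge1.
Qed.

(** The function [F (z + k) - F z] is continuous with integer values, hence locally constant. *)
Lemma derive_lattice_map (F : V -> V) x y v : continuous F -> lattice_map F ->
  x - y \is a mxOver Num.int -> 'D_v F x = 'D_v F y.
Proof.
move=> cF Fl xyZ; set k := x - y.
pose psi z := F (z + k) - F z.
have psiZ z : psi z \is a mxOver Num.int by apply: Fl; rewrite addrC addKr.
have cpsi : continuous psi.
  move=> z; apply: (@continuousB R V V (fun z => F (z + k)) F); last exact: cF.
  apply: (@continuous_comp _ _ _ (fun z : V => z + k) F); last exact: cF.
  apply: (@continuousD R V V id (fun=> k)); first exact: cvg_id.
  exact: cst_continuous.
have psi_near : \forall z \near y, F (z + k) = F z + psi y.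
  have [r r0 h] := (continuousP_dist psi).1 cpsi y 1 ltr01.
  apply/nbhs_ballP; exists r => // z; rewrite -ball_normE /= distrC => /h zy.
  have /subr0_eq <- := lattice_lt1_eq0 (lattB (psiZ z) (psiZ y)) zy.
  by rewrite /psi [RHS]addrC subrK.
have xE : x = y + k by rewrite /k [RHS]addrC subrK.
have shiftE : (fun h : R => h^-1 *: ((F \o shift x) (h *: v) - F x)) =
    (fun h => h^-1 *: (((fun z => F (z + k)) \o shift y) (h *: v) - F (y + k))).
  by apply/funext => h /=; rewrite -addrA -xE.
have addE : (fun h : R => h^-1 *: (((fun z => F z + psi y) \o shift y) (h *: v)
    - (F y + psi y))) = (fun h => h^-1 *: ((F \o shift y) (h *: v) - F y)).
  by apply/funext => h /=; rewrite opprD addrACA subrr addr0.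
have -> : 'D_v F x = 'D_v (fun z => F (z + k)) y by rewrite /derive shiftE.
by rewrite (near_eq_derive v psi_near) /derive addE.
Qed.

Context (F : V -> V).
Hypotheses (dF : forall x, differentiable F x) (Fl : lattice_map F).
Hypothesis cDF : forall i : 'I_n, continuous ('D_(delta_mx 0 i) F).

Let cF : continuous F.
Proof. by move=> x; exact: differentiable_continuous. Qed.

Lemma partials_unif_continuous (e : R) : 0 < e -> exists2 d : R, 0 < d &
  forall x z, `|z - x| < d -> forall i : 'I_n,
    `|'D_(delta_mx 0 i) F z - 'D_(delta_mx 0 i) F x| < e.
Proof.
move=> e0; pose cube : set V := [set v | forall i, v 0 i \in `[0, 1]].
have cubeK : compact cube.
  by apply: (@rV_compact R n (fun=> [set` `[0, 1]])) => _; exact: segment_compact.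
have /choice[d dP] : forall i : 'I_n, exists d : R, 0 < d /\ forall x z, cube x ->
    `|z - x| < d -> `|'D_(delta_mx 0 i) F z - 'D_(delta_mx 0 i) F x| < e.
  by move=> i; have [d d0 h] := compact_unif_continuous (@cDF i) cubeK e0; exists d.
exists (\big[Num.min/1]_i d i).
  by apply/bigmin_gtP; split=> // i _; have [] := dP i.
move=> x z zx i; have [k kZ k01] := floor_cube 0 x.
have E y : 'D_(delta_mx 0 i) F y = 'D_(delta_mx 0 i) F (y - k).
  by apply: derive_lattice_map => //; rewrite opprB addrC subrK.
rewrite (E z) (E x); have [_] := dP i; apply.
  by move=> j /=; rewrite in_itv /=; have := k01 j; rewrite mxE add0r.
by rewrite opprB addrA subrK (lt_le_trans zx)//; exact: bigmin_le.
Qed.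

Lemma strict_approx_jacobian (e : R) : 0 < e ->
  exists2 rho : R, 0 < rho & strict_approx F (jacobian F) e rho.
Proof.
move=> e0; have n1 : 0 < n%:R + 1 :> R by rewrite ltr_wpDl.
have [d d0 h] := partials_unif_continuous (divr_gt0 e0 n1).
exists (d / 2); first by rewrite divr_gt0.
move=> x y y' yx y'x.
apply: le_trans (@jacobian_approx R n F (jacobian F x) x (d / 2)
  (e / (n%:R + 1)) dF _ y y' yx y'x) _.
  move=> z zx i; rewrite row_jacobian// ltW// h//; lra.
apply: ler_wpM2r => //; rewrite mulrCA ler_piMr ?(ltW e0)//.
by rewrite ler_pdivrMr// mul1r lerDl.
Qed.

Lemma jacobian_lattice x y : x - y \is a mxOver Num.int ->
  jacobian F x = jacobian F y.
Proof.
move=> xy; apply/row_matrixP => i.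
apply: etrans (row_jacobian i (dF x)) _.
apply: etrans (esym (row_jacobian i (dF y))).
by apply: derive_lattice_map.
Qed.

Lemma norm_two_sided (a b : V) (t B s : R) : `|a - b| <= t * s ->
  2 * t * s <= `|b| -> `|b| <= B * s -> t * s <= `|a| /\ `|a| <= (B + t) * s.
Proof.
have := ler_distD b a 0; have := ler_distD a b 0.
by rewrite !subr0 [`|b - a|]distrC => h1 h2 h3 h4 h5; split; lra.
Qed.

Lemma row_jacobianB x y i : row i (jacobian F x - jacobian F y) =
  'D_(delta_mx 0 i) F x - 'D_(delta_mx 0 i) F y.
Proof. by rewrite -!row_jacobian//; apply/rowP => j; rewrite !mxE. Qed.

Lemma jacobian_local_bounds x0 : jacobian F x0 \in unitmx ->
  exists d : R, exists t : R, exists B : R, [/\ 0 < d, 0 < t, 0 < B &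
    forall x v, `|x - x0| < d ->
      t * `|v| <= `|v *m jacobian F x| /\ `|v *m jacobian F x| <= (B + t) * `|v|].
Proof.
move=> Ju; have n1 : 0 < n%:R + 1 :> R by rewrite ltr_wpDl.
have [B B0 hB] := mulmx_norm_bound (jacobian F x0).
have [B' B'0 hB'] := mulmx_norm_bound (invmx (jacobian F x0)).
pose t := (2 * B')^-1; have t0 : 0 < t by rewrite invr_gt0 mulr_gt0.
have [d d0 hd] := partials_unif_continuous (divr_gt0 t0 n1).
exists d, t, B; split; [exact: d0|exact: t0|exact: B0|move=> x v xx0].
have diff : `|v *m (jacobian F x - jacobian F x0)| <= t * `|v|.
  have h i : `|row i (jacobian F x - jacobian F x0)| <= t / (n%:R + 1).
    by rewrite row_jacobianB; apply/ltW; exact: hd.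
  apply: le_trans (mulmx_norm_le v h) _; apply: ler_wpM2r => //.
  by rewrite mulrCA ler_piMr ?(ltW t0)// ler_pdivrMr// mul1r lerDl.
have low : 2 * t * `|v| <= `|v *m jacobian F x0|.
  have := hB' (v *m jacobian F x0); rewrite mulmxK// => h.
  by rewrite /t invfM mulrA divff ?mul1r ?pnatr_eq0// ler_pdivrMl.
rewrite mulmxBr in diff; exact: norm_two_sided diff low (hB v).
Qed.

Lemma jacobian_bounds : (forall x, jacobian F x \in unitmx) ->
  exists2 c : R, 0 < c & forall x v,
    c * `|v| <= `|v *m jacobian F x| /\ `|v *m jacobian F x| <= c^-1 * `|v|.
Proof.
move=> Ju; pose cube : set V := [set v | forall i, v 0 i \in `[0, 1]].
have cubeK : compact cube.
  by apply: (@rV_compact R n (fun=> [set` `[0, 1]])) => _; exact: segment_compact.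
pose P (c : R) x := forall v,
  c * `|v| <= `|v *m jacobian F x| /\ `|v *m jacobian F x| <= c^-1 * `|v|.
have : \forall c \near 0^'+, cube `<=` P c.
  move/compact_near_coveringP : cubeK; apply => x0 _.
  have [d [t [B [d0 t0 B0 h]]]] := jacobian_local_bounds (Ju x0).
  exists (ball x0 d, [set c | 0 < c < Num.min t (B + t)^-1]).
    split=> /=; first exact: nbhsx_ballx.
    near=> c; apply/andP; split; first by near: c; exact: nbhs_right_gt.
    by near: c; apply: nbhs_right_lt; rewrite lt_min t0 invr_gt0 addr_gt0.
  move=> [x c] /= []; rewrite -ball_normE /= distrC => xx0.
  rewrite lt_min => /andP[c0 /andP[ct cB]] v; have [h1 h2] := h x v xx0; split.
    by apply: le_trans h1; rewrite ler_wpM2r// ltW.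
  apply: le_trans h2 _; rewrite ler_wpM2r// -[leLHS]invrK ltW//.
  by rewrite ltf_pV2// posrE ?invr_gt0 ?addr_gt0.
move=> nearP; near (0 : R)^'+ => c.
exists c; first by near: c; exact: nbhs_right_gt.
move=> x v; have Pc : cube `<=` P c by near: c.
have [k kZ k01] := floor_cube 0 x.
have -> : jacobian F x = jacobian F (x - k).
  by apply: jacobian_lattice; rewrite opprB addrC subrK.
apply: Pc => i /=; rewrite in_itv /=.
by have := k01 i; rewrite mxE add0r.
Unshelve. all: by end_near. Qed.

End PeriodicDerivative.

(** * Dense orbits *)

Section MatrixComplete.
Context (R : realType) (m n : nat).

Lemma mx_norm_lt (M : 'M[R]_(m, n)) (e : R) : 0 < e ->
  `|M| < e <-> forall i j, `|M i j| < e.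
Proof.
move=> e0; rewrite [X in X < _]/Num.Def.normr /= mx_normrE; split=> [Me i j|Me].
  apply: le_lt_trans Me; apply/bigmax_geP; right => /=.
  by exists (i, j).
by apply/bigmax_ltP; split => // -[i j] _; exact: Me.
Qed.

HB.instance Definition _ := Complete.on 'M[R]_(m, n).

End MatrixComplete.


Section DenseOrbit.
Context (R : realType) (n : nat).
Local Notation V := 'rV[R]_n.
Implicit Types (x y z q v w : V) (G : V -> V).

Lemma iter_continuous G k : continuous G -> continuous (iter k G).
Proof.
move=> cG; elim: k => [|k IH] x; first exact: cvg_id.
by apply: (@continuous_comp _ _ _ (iter k G) G); [exact: IH|exact: cG].
Qed.

Lemma rat_vector_dense x (e : R) : 0 < e ->
  exists q : 'rV[rat]_n, `|map_mx ratr q - x| < e.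
Proof.
move=> e0; have /choice[q qP] : forall i, exists a : rat,
    x 0 i - e < ratr a < x 0 i + e.
  move=> i; have [|a] := @rat_in_itvoo R (x 0 i - e) (x 0 i + e); first by lra.
  by rewrite in_itv /= => h; exists a.
exists (\row_i q i); apply/mx_norm_lt => // i j; rewrite !mxE (ord1 i).
by have /andP[] := qP j; rewrite ltr_norml; lra.
Qed.

(** Baire in R^n, with orbits read modulo the lattice. The points whose orbit enters a given
    rational ball form an open set, which is dense because it contains the preorbit of the
    centre. *)
Lemma dense_orbit G : continuous G ->
  (forall q x (r : R), 0 < r -> exists w k,
    `|w - q| <= r /\ iter k G w - x \is a mxOver Num.int) ->
  exists x, forall q (e : R), 0 < e -> exists k w,
    iter k G x - w \is a mxOver Num.int /\ `|w - q| < e.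
Proof.
move=> cG Gdense.
pose hits (qj : 'rV[rat]_n * nat) : set V := [set x | exists k w,
  iter k G x - w \is a mxOver Num.int /\ `|w - map_mx ratr qj.1| < qj.2.+1%:R^-1].
pose O (i : nat) : set V := if unpickle i is Some qj then hits qj else setT.
have hits_open qj : open (hits qj).
  rewrite openE => x [k [w [xw wq]]].
  pose s := qj.2.+1%:R^-1 - `|w - map_mx ratr qj.1|.
  have s0 : 0 < s by rewrite subr_gt0.
  have [r r0 h] := (continuousP_dist (iter k G)).1 (@iter_continuous G k cG) x s s0.
  apply/nbhs_ballP; exists r => // y; rewrite -ball_normE /= distrC => /h xy.
  exists k, (iter k G y - (iter k G x - w)); split.
    by rewrite opprB addrC subrK.
  have -> : iter k G y - (iter k G x - w) - map_mx ratr qj.1 =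
      (iter k G y - iter k G x) + (w - map_mx ratr qj.1).
    by apply/rowP => i; rewrite !mxE; ring.
  by apply: le_lt_trans (ler_normD _ _) _; rewrite -ltrBrDr.
have hits_dense qj : dense (hits qj).
  move=> D [x Dx]; rewrite openE => /(_ x Dx)/nbhs_ballP[r /= r0 xD].
  have [w [k [wx Gw]]] := Gdense x (map_mx ratr qj.1) _ (divr_gt0 r0 (ltr0n _ 2)).
  exists w; split.
    by apply: xD; rewrite -ball_normE /= distrC (le_lt_trans wx)// ltr_pdivrMr//; lra.
  by exists k, (map_mx ratr qj.1); split => //; rewrite subrr normr0 invr_gt0.
have /Baire Odense : forall i, open (O i) /\ dense (O i).
  move=> i; rewrite /O; case: unpickle => [qj|]; first by split.
  by split=> [|D D0 _]; [exact: openT|rewrite setIT].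
have [|x [_ Ox]] := Odense setT _ openT; first by exists 0.
exists x => q e e0; have e2 : 0 < e / 2 by rewrite divr_gt0.
have [q' q'q] := rat_vector_dense q e2.
pose j := Num.truncn (e / 2)^-1.
have je : j.+1%:R^-1 < e / 2.
  by rewrite invf_plt// ?posrE ?ltr0n// /j truncnS_gt.
have := Ox (pickle (q', j)) I; rewrite /O pickleK => -[k [w [xw wq]]].
exists k, w; split => //.
apply: le_lt_trans (ler_distD (map_mx ratr q') w q) _.
by rewrite [ltRHS]splitr ltrD// (lt_trans wq).
Qed.

End DenseOrbit.

(** * Lifts of torus maps *)

Section TorusLifts.
Context (R : realType) (n : nat).
Local Notation V := 'rV[R]_n.
Local Notation proj := (@torus_proj R n).
Implicit Types (x y z q v w : V) (G : V -> V).

Lemma proj_eq x y : proj x = proj y <-> x - y \is a mxOver Num.int.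
Proof. by split=> [/torus_projP|xy]; [|apply/torus_projP]. Qed.

Definition lifts G (g : torus R n -> torus R n) := forall x, proj (G x) = g (proj x).

Lemma lifts_lattice_map G g : lifts G g -> lattice_map G.
Proof. by move=> Gg x y /proj_eq xy; apply/proj_eq; rewrite !Gg xy. Qed.

Lemma lifts_iter G g k x : lifts G g -> proj (iter k G x) = iter k g (proj x).
Proof. by move=> Gg; elim: k => //= k <-; exact: Gg. Qed.

Lemma torus_openP (O : set (torus R n)) : open O <-> open (proj @^-1` O).
Proof. by []. Qed.

Lemma proj_ball_open q (e : R) : open [set p | exists2 w, `|w - q| < e & proj w = p].
Proof.
apply/torus_openP; rewrite openE => x [w wq /proj_eq wx].
apply/nbhs_ballP; exists (e - `|w - q|) => /=; first by rewrite subr_gt0.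
move=> y; rewrite -ball_normE /= ltrBrDr => xy.
exists (w + (y - x)).
  have -> : w + (y - x) - q = (y - x) + (w - q) by apply/rowP => i; rewrite !mxE; ring.
  by rewrite (le_lt_trans (ler_normD _ _))// [`|y - x|]distrC.
apply/proj_eq; rewrite (_ : _ - y = w - x)//.
by apply/rowP => i; rewrite !mxE; ring.
Qed.

Lemma dense_preorbit_lift r (g : endo R n r) G x : lifts G g ->
  dense (preorbit g (proj x)) -> forall q (e : R), 0 < e -> exists w k,
    `|w - q| < e /\ iter k G w - x \is a mxOver Num.int.
Proof.
move=> Gg gx q e e0.
have [|p [[w wq <-] [k gw]]] := gx _ _ (@proj_ball_open q e).
  by exists (proj q), q; rewrite // subrr normr0.
by exists w, k; split => //; apply/proj_eq; rewrite (lifts_iter _ _ Gg).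
Qed.

Lemma lift_dense_preorbit r (g : endo R n r) G x : lifts G g ->
  (forall q (e : R), 0 < e -> exists w k,
    `|w - q| <= e /\ iter k G w - x \is a mxOver Num.int) ->
  dense (preorbit g (proj x)).
Proof.
move=> Gg H O [p Op] /torus_openP; rewrite openE.
have [q qp] := torus_proj_surj p.
move=> /(_ q); rewrite /= qp => /(_ Op) /nbhs_ballP[e /= e0 qO].
have [w [k [wq wx]]] := H q (e / 2) (divr_gt0 e0 (ltr0n _ 2)).
exists (proj w); split.
  by apply: qO; rewrite -ball_normE /= distrC (le_lt_trans wq)// ltr_pdivrMr//; lra.
by exists k; rewrite -(lifts_iter _ _ Gg); apply/proj_eq.
Qed.

Lemma lift_transitive r (g : endo R n r) G : lifts G g -> continuous G ->
  (forall q x (e : R), 0 < e -> exists w k,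
    `|w - q| <= e /\ iter k G w - x \is a mxOver Num.int) ->
  topologically_transitive g.
Proof.
move=> Gg cG H; have [x Hx] := dense_orbit cG H.
exists (proj x) => O [p Op] /torus_openP; rewrite openE.
have [q qp] := torus_proj_surj p.
move=> /(_ q); rewrite /= qp => /(_ Op) /nbhs_ballP[e /= e0 qO].
have [k [w [xw wq]]] := Hx q e e0.
exists (proj w); split; first by apply: qO; rewrite -ball_normE /= distrC.
by exists k => //; rewrite -(lifts_iter _ _ Gg); apply/proj_eq.
Qed.

Lemma Cr_continuous r (F : V -> V) : Cr r F -> continuous F.
Proof. by case: r => // r [dF _] x; exact: differentiable_continuous. Qed.

(** Closeness on the torus only says that [G z - F z] is near some integer vector [m z]. Between
    points at distance at most 1, [m] varies by less than [(n + 2) * e < 1], so it is constant, and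
    [G - m 0] is the required lift. *)
Lemma perturb_of_Cr_ball r (f : endo R n r.+1) (kappa : R) : 0 < kappa ->
  exists2 e : R, 0 < e & forall g, Cr_ball f e g ->
    exists2 G, lifts G g & perturb (lift_of f) kappa G.
Proof.
move=> kappa0; set F := lift_of f.
have n1 : 0 < n%:R + 3 :> R by rewrite ltr_wpDl.
pose e := Num.min (kappa / (n%:R + 3)) (1 / (2 * (n%:R + 3))).
have e0 : 0 < e by rewrite lt_min !divr_gt0 ?mulr_gt0.
have e1 : (n%:R + 3) * e <= kappa by rewrite mulrC -ler_pdivlMr// ge_min lexx.
have e2 : (n%:R + 3) * e < 1.
  rewrite mulrC -ltr_pdivlMr// gt_min; apply/orP; right.
  by rewrite !div1r ltf_pV2 ?posrE ?mulr_gt0// ltr_pMl// ltr1n.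
exists e => // g [fg0 fg1]; set G := lift_of g.
have [[dF _] Ff] := lift_ofP f; have [[dG _] Gg] := lift_ofP g.
have lip y y' : `|(G y - F y) - (G y' - F y')| <= n%:R * e * `|y - y'|.
  apply: (@lipschitz_partials R n (fun z => G z - F z)).
    by move=> z; apply: (@differentiableB _ _ _ G F).
  move=> z i; rewrite (@deriveB _ _ _ G F); [|exact: diff_derivable..].
  by rewrite distrC ltW//; exact: (fg1 [:: i] isT z).
have /choice[m mP] : forall z, exists m : V,
    m \is a mxOver Num.int /\ `|G z - F z - m| < e.
  move=> z; have [x [y [/esym xE /esym yE xy]]] := fg0 (proj z).
  rewrite -Ff in xE; rewrite -Gg in yE.
  exists ((G z - y) - (F z - x)); split.
    by apply: lattB; apply/proj_eq.
  have -> : G z - F z - (G z - y - (F z - x)) = y - x.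
    by apply/rowP => i; rewrite !mxE; ring.
  by rewrite distrC.
have ne0 : 0 <= n%:R * e by rewrite mulr_ge0// ltW.
have mstep y y' : `|y - y'| <= 1 -> m y = m y'.
  move=> yy'; apply/subr0_eq/lattice_lt1_eq0.
    by have [h _] := mP y; have [h' _] := mP y'; exact: lattB.
  have [_ h] := mP y; have [_ h'] := mP y'; have l := lip y y'.
  have -> : m y - m y' = (G y - F y - (G y' - F y')) - (G y - F y - m y) +
      (G y' - F y' - m y').
    by apply/rowP => i; rewrite !mxE; ring.
  have l1 : n%:R * e * `|y - y'| <= n%:R * e * 1 by rewrite ler_wpM2l.
  apply: le_lt_trans (ler_normD _ _) _.
  by have := ler_normB (G y - F y - (G y' - F y')) (G y - F y - m y); lra.
have mconst k z : `|z| <= k%:R -> m z = m 0.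
  elim: k z => [|k IH] z zk; first by congr m; apply/eqP; rewrite -normr_le0.
  have k0 : 0 < k.+1%:R :> R by rewrite ltr0n.
  rewrite -(IH ((k%:R / k.+1%:R) *: z)); last first.
    rewrite normrZ ger0_norm ?divr_ge0// mulrAC ler_pdivrMr//.
    by rewrite ler_wpM2l.
  apply: mstep; rewrite (_ : _ - _ = k.+1%:R^-1 *: z).
    by rewrite normrZ gtr0_norm ?invr_gt0// ler_pdivrMl// mulr1.
  have kE : k%:R = k.+1%:R - 1 :> R by rewrite -natr1 addrK.
  by apply/rowP => i; rewrite !mxE kE; field; rewrite gt_eqF.
exists (fun z => G z - m 0).
  move=> z; rewrite -Gg; apply/proj_eq; rewrite addrAC subrr add0r.
  by apply: lattN; have [] := mP 0.
split=> [z|y y'].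
  have [_ h] := mP z; rewrite (@mconst (Num.truncn `|z|).+1) in h; last first.
    by rewrite ltW// truncnS_gt.
  rewrite addrAC ltW// (lt_le_trans h)//.
  by apply: le_trans e1; rewrite ler_peMl ?(ltW e0)// ler_wpDl// ler1n.
have -> : G y - m 0 - F y - (G y' - m 0 - F y') = G y - F y - (G y' - F y').
  by apply/rowP => i; rewrite !mxE; ring.
apply: le_trans (lip y y') _; rewrite ler_wpM2r//; apply: le_trans e1.
by rewrite ler_wpM2r ?(ltW e0)// lerDl.
Qed.

End TorusLifts.

(** * Comparison of norms, and expansion from the conorm *)

Section NormEquivalence.
Context (R : realType) (n' : nat).
Local Notation n := n'.+1.
Local Notation V := 'rV[R]_n.
Implicit Types (v w : V) (M : 'M[R]_n).
Context (N : V -> R) (hN : is_norm N).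

Let ND v w : N (v + w) <= N v + N w. Proof. by case: hN. Qed.
Let NZ (a : R) v : N (a *: v) = `|a| * N v. Proof. by case: hN. Qed.
Let N_eq0 v : N v = 0 -> v = 0. Proof. by case: hN => _ _; exact. Qed.

Lemma is_norm0 : N 0 = 0.
Proof. by rewrite -(scale0r 0) NZ normr0 mul0r. Qed.

Lemma is_normN v : N (- v) = N v.
Proof. by rewrite -scaleN1r NZ normrN1 mul1r. Qed.

Lemma is_norm_ge0 v : 0 <= N v.
Proof.
by have := ND v (- v); rewrite subrr is_norm0 is_normN -mulr2n pmulrn_lge0.
Qed.

Lemma is_norm_ub : exists2 b : R, 0 < b & forall v, N v <= b * `|v|.
Proof.
pose b := \sum_i N (delta_mx 0 i) + 1.
have b0 : 0 <= \sum_i N (delta_mx 0 i) by apply: sumr_ge0 => i _; exact: is_norm_ge0.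
exists b; first by rewrite ltr_wpDl.
move=> v; have Nsum (s : seq 'I_n) :
    N (\sum_(i <- s) v 0 i *: delta_mx 0 i) <= \sum_(i <- s) `|v 0 i| * N (delta_mx 0 i).
  elim: s => [|i s IH]; first by rewrite !big_nil is_norm0.
  by rewrite !big_cons; apply: le_trans (ND _ _) _; rewrite NZ lerD2l.
rewrite [in N v](row_sum_delta v); apply: le_trans (Nsum _) _.
apply: (@le_trans _ _ (\sum_i `|v| * N (delta_mx 0 i))).
  by apply: ler_sum => i _; rewrite ler_wpM2r ?is_norm_ge0//; exact: coord_le_norm.
by rewrite -mulr_sumr mulrC ler_wpM2r// lerDl.
Qed.

Lemma is_norm_lb : exists2 b : R, 0 < b & forall v, b * `|v| <= N v.
Proof.
have [B B0 hB] := is_norm_ub.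
have cN : continuous N.
  apply: (@locally_lipschitz_continuous R V R N B 1) => // x y _.
  have h1 := hB (y - x); have := ND (y - x) x; have := ND (x - y) y.
  rewrite !subrK -opprB is_normN ler_norml => h2 h3; apply/andP; split; lra.
pose S : set V := [set v | `|v| = 1].
have S0 : S !=set0.
  exists (const_mx 1); apply/eqP; rewrite eq_le; apply/andP; split.
    by apply: rV_norm_le => // i; rewrite mxE normr1.
  by have := coord_le_norm (const_mx 1 : V) ord0; rewrite mxE normr1.
have cS : compact S.
  apply: (@subclosed_compact _ _ [set y : V | `|y - 0| <= 1])
    (@compact_cball R n 0 1) _.
    apply: (@preimage_closed _ _ (fun v : V => `|v|) [set t : R | t = 1]).
      by move=> v _; exact: norm_continuous.
    exact: closed_eq.
  by move=> v /= v1; rewrite subr0 v1.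
have [|v0] := @EVT_min_rV R n N S S0 cS; first exact: continuous_subspaceT.
rewrite inE => v01 v0min.
have Nv0 : 0 < N v0.
  rewrite lt_neqAle is_norm_ge0 andbT eq_sym; apply/eqP => /N_eq0 v00.
  by move: v01; rewrite /S /= v00 normr0 => /esym/eqP; rewrite oner_eq0.
exists (N v0) => // v; have [->|v_neq0] := eqVneq v 0.
  by rewrite normr0 mulr0 is_norm0.
have vpos : 0 < `|v| by rewrite normr_gt0.
have := v0min (`|v|^-1 *: v); rewrite inE /S /= normrZ normfV normr_id.
rewrite mulVf ?gt_eqF// => /(_ erefl); rewrite NZ normfV normr_id.
by rewrite ler_pdivlMl// [_ * N v0]mulrC.
Qed.

(** The [sup] defining [opnorm] bounds its set only if that set is bounded above, which follows from
    the equivalence of [N] with the maximum norm. *)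
Lemma conorm_expansion M (lambda : R) v : 0 < lambda -> M \in unitmx ->
  lambda < conorm N M -> lambda * N v <= N (v *m M).
Proof.
move=> l0 Mu; rewrite /conorm; set o := opnorm N (invmx M) => lo.
have o0 : 0 < o by rewrite -invr_gt0 (lt_trans l0).
have [B B0 hB] := is_norm_ub; have [b b0 hb] := is_norm_lb.
have [K K0 hK] := mulmx_norm_bound (invmx M).
have ub u : N u <= 1 -> N (u *m invmx M) <= o.
  move=> u1; apply: ub_le_sup; last by exists u.
  exists (B * (K * b^-1)) => _ [w w1 <-]; apply: le_trans (hB _) _.
  rewrite ler_wpM2l ?(ltW B0)//; apply: le_trans (hK w) _.
  by rewrite ler_wpM2l ?(ltW K0)// -[leRHS]mulr1 ler_pdivlMl// (le_trans (hb w)).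
have homog u : N (u *m invmx M) <= o * N u.
  have [->|u0] := eqVneq u 0; first by rewrite mul0mx is_norm0 mulr0.
  have Nu : 0 < N u.
    by rewrite lt_neqAle is_norm_ge0 andbT eq_sym; apply: contra u0 => /eqP/N_eq0 ->.
  have := ub ((N u)^-1 *: u); rewrite NZ -scalemxAl NZ normfV (ger0_norm (ltW Nu)).
  by rewrite mulVf ?gt_eqF// lexx => /(_ isT); rewrite ler_pdivrMl// mulrC.
have := homog (v *m M); rewrite mulmxK// => h.
have : lambda * o <= 1 by rewrite -ler_pdivlMr// mul1r ltW.
rewrite mulrC => lo1; have N0 := is_norm_ge0 (v *m M).
apply: (@le_trans _ _ (lambda * (o * N (v *m M)))); first by rewrite ler_wpM2l// ltW.
by rewrite mulrA [lambda * o]mulrC ler_piMl.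
Qed.

End NormEquivalence.

(** * Robust transitivity *)

Section Lifted.
Context (R : realType) (n' : nat).
Local Notation n := n'.+1.
Local Notation V := 'rV[R]_n.
Local Notation proj := (@torus_proj R n).
Implicit Types (x y z q v w k : V) (U : set (torus R n)).

Lemma norm_delta (i : 'I_n) : `|delta_mx 0 i : V| = 1.
Proof.
apply/eqP; rewrite eq_le; apply/andP; split.
  apply: rV_norm_le => // j; rewrite mxE eqxx.
  by case: (j == i); rewrite ?normr1 ?normr0.
by have := coord_le_norm (delta_mx 0 i : V) i; rewrite mxE !eqxx normr1.
Qed.

Lemma delta_int (i : 'I_n) : (delta_mx 0 i : V) \is a mxOver Num.int.
Proof.
by apply/mxOverP => a b; rewrite mxE; case: (_ && _); rewrite ?rpred1 ?rpred0.
Qed.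

Lemma delta_neq0 (i : 'I_n) : (delta_mx 0 i : V) != 0.
Proof. by rewrite -normr_eq0 norm_delta oner_eq0. Qed.

(* Empty unless [k] is an integer vector. *)
Definition lift_piece a U k : set V :=
  [set x | k \is a mxOver Num.int /\ lift_in a U (x - k)].

Lemma lift_piece_cover a U x : U (proj x) -> exists k, lift_piece a U k x.
Proof.
move=> Ux; have [k kZ kc] := floor_cube a x; exists k; split=> //; split=> //.
rewrite /preimage /=; have -> // : torus_proj (x - k) = proj x.
by apply/proj_eq; rewrite addrAC subrr add0r; exact: lattN.
Qed.

Lemma lift_piece_diam a U k x y : (diam (lift_in a U) < 1)%E ->
  lift_piece a U k x -> lift_piece a U k y -> `|x - y| <= 1.
Proof.
move=> dU [_ xU] [_ yU]; rewrite -lee_fin ltW//; apply: le_lt_trans dU.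
apply: ereal_sup_ubound; exists (x - k) => //; exists (y - k) => //.
by congr (`|_|%:E); apply/rowP => i; rewrite !mxE; ring.
Qed.

Lemma lift_piece_dist a U k k' x y (d : R) : (d%:E <= diam_int_compl a U)%E ->
  k <> k' -> lift_piece a U k x -> lift_piece a U k' y -> d <= `|x - y|.
Proof.
move=> dU kk' [kZ xU] [k'Z yU]; rewrite -lee_fin; apply: le_trans dU _.
pose l := k' - k.
apply: (@le_trans _ _ (set_dist (lift_in a U) [set z + l | z in lift_in a U])).
  apply: ereal_inf_lbound; exists l => //; split; first exact: lattB.
  by rewrite subr_eq0; apply/eqP => /esym.
apply: ereal_inf_lbound; exists (x - k) => //; exists (y - k' + l).
  by exists (y - k').
by congr (`|_|%:E); apply/rowP => i; rewrite /l !mxE; ring.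
Qed.

(** A point and its translate by a unit vector are at distance 1. This yields [delta0 < 1] for
    nonempty [U0]. *)
Lemma diam_int_le1 a U x : U (proj x) -> (diam_int_compl a U <= 1)%E.
Proof.
move=> /(lift_piece_cover a)[k [_ xU]].
pose l : V := delta_mx 0 ord0.
apply: (@le_trans _ _ (set_dist (lift_in a U) [set z + l | z in lift_in a U])).
  apply: ereal_inf_lbound; exists l => //.
  by split; [exact: delta_int|exact: delta_neq0].
apply: ereal_inf_lbound; exists (x - k) => //; exists (x - k + l).
  by exists (x - k).
by rewrite opprD addrA subrr sub0r normrN norm_delta.
Qed.

(* The corner [a] of the frame lies on the boundary of the cube. *)
Lemma adapted_frame_corner a U : adapted_frame a U -> ~ U (proj a).
Proof.
move=> fr Ua; have : (cube a)° a.
  apply: fr; apply: subset_closure; split=> // i.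
  by rewrite lexx lerDl ler01.
move=> /nbhs_ballP[r /= r0 /(_ (a - (r / 2) *: delta_mx 0 ord0))].
rewrite -ball_normE /= opprB addrC subrK normrZ norm_delta mulr1.
rewrite gtr0_norm ?divr_gt0// => h.
have /h/(_ ord0) : r / 2 < r by rewrite ltr_pdivrMr//; lra.
by rewrite !mxE !eqxx mulr1; lra.
Qed.

End Lifted.

Lemma robust_preorbit_density (R : realType) (n' r' : nat)
    (N : 'rV[R]_n'.+1 -> R) (hN : is_norm N)
    (f : endo R n'.+1 r'.+1) (hvol : volume_expanding f)
    (hdense : forall x, dense (preorbit f x))
    (U0 : set (torus R n'.+1)) (hexp : expanding_in N f (~` U0))
    (a : 'rV[R]_n'.+1) (hframe : adapted_frame a U0)
    (hdiam : (diam (lift_in a U0) < 1)%E)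
    (delta0 : R) (hdelta0 : 0 < delta0)
    (hdelta0_int : (delta0%:E < diam_int_compl a U0)%E)
    (harc : forall (gamma : R -> torus R n'.+1) (c : R -> 'rV[R]_n'.+1),
        torus_arc gamma -> arc_lift gamma c ->
        arc_trace gamma `<=` ~` U0 ->
        (delta0%:E < diam (arc_trace c))%E ->
        exists2 y, (arc_trace gamma) y &
          forall k, (1 <= k)%N -> (~` U0) (iter k f y)) :
  exists2 e : R, 0 < e & forall g, Cr_ball f e g ->
    exists G, [/\ lifts G g, continuous G & forall q x (s : R), 0 < s ->
      exists w k, `|w - q| <= s /\ iter k G w - x \is a mxOver Num.int].
Proof.
set n := n'.+1 in N hN f hvol hdense U0 hexp a hframe hdiam hdelta0_int harc *.
pose proj := @torus_proj R n.
pose F := lift_of f; have [[dF DF] Ff] := lift_ofP f.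
have cF : continuous F by move=> x; exact: differentiable_continuous.
have Fl : lattice_map F by exact: lifts_lattice_map Ff.
have cDF i : continuous ('D_(delta_mx 0 i) F) by apply: Cr_continuous (DF i).
pose L (x : 'rV[R]_n) := jacobian F x.
have LE (x : 'rV[R]_n) : L x = tangent f (proj x).
  apply: jacobian_lattice => //; apply/proj_eq.
  by rewrite {2}/torus_proj reprK.
have [sigma sigma1 hsigma] := hvol.
have Lsigma (x : 'rV[R]_n) : sigma <= `|\det (L x)| by rewrite LE ltW.
have Lunit (x : 'rV[R]_n) : L x \in unitmx.
  rewrite unitmxE unitfE -normr_gt0; apply: lt_le_trans (Lsigma x).
  exact: lt_trans sigma1.
have [c0 c00 cb] := jacobian_bounds dF Fl cDF Lunit.
have Lge (x v : 'rV[R]_n) : c0 * `|v| <= `|v *m L x| by have [] := cb x v.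
have Lle (x v : 'rV[R]_n) : `|v *m L x| <= c0^-1 * `|v| by have [] := cb x v.
have FL := strict_approx_jacobian dF Fl cDF.
have [bl0 bl00 hbl0] := is_norm_lb hN; have [bu bu0 Nub] := is_norm_ub hN.
pose bl := Num.min bl0 bu.
have bl_gt0 : 0 < bl by rewrite lt_min bl00.
have bl_bu : bl <= bu by rewrite ge_min lexx orbT.
have Nlb (v : 'rV[R]_n) : bl * `|v| <= N v.
  by apply: le_trans (hbl0 v); rewrite ler_wpM2r// ge_min lexx.
have [ND NZ _] := hN.
pose A : set 'rV[R]_n := [set x | ~ U0 (proj x)].
have A0 : A !=set0 by exists a; exact: adapted_frame_corner hframe.
have [lambda lambda1 hlambda] := hexp.
have Lexp (x v : 'rV[R]_n) : A x -> lambda * N v <= N (v *m L x).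
  move=> Ax; have [Tu Tl] := hlambda (proj x) Ax; rewrite LE.
  by apply: conorm_expansion => //; exact: lt_trans lambda1.
(* The internal diameter is infinite when [U0] is empty, so a finite value above [delta0] is
   extracted. *)
have [delta1 d01 hd1] : exists2 d : R, delta0 < d & (d%:E <= diam_int_compl a U0)%E.
  move: hdelta0_int; case: (diam_int_compl a U0) => [d|_|//].
    by rewrite lte_fin => h; exists d.
  by exists (delta0 + 1); rewrite ?ltrDl ?leey.
have AE (x : 'rV[R]_n) : (forall k, ~ lift_piece a U0 k x) -> A x.
  by move=> h /(lift_piece_cover a)[k]; exact: h.
have d0lt1 : (forall x, A x) \/ delta0 < 1.
  have [h|/existsNP[x /contrapT Ux]] := pselect (forall x, A x); [by left|right].
  by rewrite -lte_fin; apply: lt_le_trans hdelta0_int (diam_int_le1 a Ux).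
(* Two points of [c] with the same projection differ by an integer vector of norm below 1, hence
   coincide: [proj \o c] is an arc. *)
have harc' (c : R -> 'rV[R]_n) : continuous c -> {in `[0, 1] &, injective c} ->
    (forall s t, s \in `[0, 1] -> t \in `[0, 1] -> `|c s - c t| < 1) ->
    (forall t, t \in `[0, 1] -> A (c t)) -> delta0 < `|c 0 - c 1| ->
    exists2 t, t \in `[0, 1] & forall k, (1 <= k)%N -> A (iter k F (c t)).
  move=> cc cinj cd cA c01.
  have cpc : continuous (proj \o c).
    move=> t; apply: (@continuous_comp _ _ _ c proj); first exact: cc.
    exact: pi_continuous.
  have [||||y [t t01 <-] hy] := harc (proj \o c) c.
  - split; first exact: continuous_subspaceT.
    move=> s t s01 t01 /proj_eq st; apply: cinj => //.
    by apply/subr0_eq/lattice_lt1_eq0 => //; exact: cd.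
  - by split => //; exact: continuous_subspaceT.
  - by move=> _ [t t01 <-]; exact: cA.
  - rewrite -lte_fin in c01; apply: lt_le_trans c01 _.
    apply: ereal_sup_ubound; exists (c 0).
      by exists 0; rewrite //= in_itv /= lexx ler01.
    by exists (c 1) => //; exists 1; rewrite //= in_itv /= lexx ler01.
  exists t => // k k1; have := hy k k1.
  by rewrite /A /= -(lifts_iter _ _ Ff).
have c0V : 0 <= c0^-1 by rewrite invr_ge0 ltW.
have [kappa1 k10 [eps0 eps00 core]] :=
  iterates_contain_ball ND NZ bl_gt0 Nlb Nub bl_bu A0 cF c00 c0V
    sigma1 lambda1 FL Lunit Lge Lle Lsigma Lexp AE
    (fun k x y => @lift_piece_diam R n' a U0 k x y hdiam)
    (fun k k' x y => @lift_piece_dist R n' a U0 k k' x y delta1 hd1)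
    hdelta0 d01 d0lt1 harc'.
have c04 : 0 < c0 / 4 by rewrite divr_gt0.
have c08 : 0 < c0 / 8 by rewrite divr_gt0.
have [rho rho0 FLrho] := FL _ c08.
have Gsurj G : perturb F (c0 / 8) G -> forall x w (s : R), 0 <= s -> s <= rho ->
    `|w - G x| <= c0 / 4 * s -> exists2 y, `|y - x| <= s & G y = w.
  move=> PG; apply: (@local_surjection R n G L c0 (c0 / 8 + c0 / 8) rho) => //.
  - exact: perturb_continuous PG.
  - lra.
  - exact: strict_approx_perturb PG.
have Fdense q x (e : R) : 0 < e -> exists w k,
    `|w - q| < e /\ iter k F w - x \is a mxOver Num.int.
  by move=> e0; exact: dense_preorbit_lift Ff (hdense (proj x)) q e e0.
have [kappa2 k20 robust] := robust_density c04 rho0 c08 Gsurj Fdense eps00.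
have k120 : 0 < Num.min kappa1 kappa2 by rewrite lt_min k10.
have [e e0 he] := perturb_of_Cr_ball f k120.
exists e => // g /he[G Gg PG]; exists G; split => //.
  exact: perturb_continuous PG.
have PG1 : perturb F kappa1 G by apply: perturb_le PG; rewrite ge_min lexx.
have PG2 : perturb F kappa2 G by apply: perturb_le PG; rewrite ge_min lexx orbT.
move=> q x s s0; have [K [q' hq']] := core G PG1 q s s0.
have [w [k [wq' wx]]] := robust G PG2 (lifts_lattice_map Gg) q' x.
have [y yq yw] := hq' w wq'.
by exists y, (k + K)%N; rewrite iterD yw.
Qed.

Theorem mainTheorem1 (R : realType) (n r : nat) (hn : (2 <= n)%N)
    (hr : (1 <= r)%N)
    (N : 'rV[R]_n -> R) (hN : is_norm N)
    (f : endo R n r) (hvol : volume_expanding f)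
    (hdense : forall x, dense (preorbit f x))
    (* (1) *)
    (U0 : set (torus R n)) (hU0 : open U0)
    (hexp : expanding_in N f (~` U0))
    (a : 'rV[R]_n) (hframe : adapted_frame a U0)
    (hdiam : (diam (lift_in a U0) < 1)%E)
    (* (2) *)
    (delta0 : R) (hdelta0 : 0 < delta0)
    (hdelta0_int : (delta0%:E < diam_int_compl a U0)%E)
    (U1 : set (torus R n)) (hU1 : open U1) (hU01 : closure U0 `<=` U1)
    (harc : forall (gamma : R -> torus R n) (c : R -> 'rV[R]_n),
        torus_arc gamma -> arc_lift gamma c ->
        arc_trace gamma `<=` ~` U0 ->
        (delta0%:E < diam (arc_trace c))%E ->
        exists2 y, (arc_trace gamma) y &
          forall k, (1 <= k)%N -> (~` U1) (iter k f y))
    (* (3) *)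
    (hback : forall z, (~` U1) z -> exists2 zbar, (~` U1) zbar & f zbar = z) :
  (\forall g \near f, forall x, dense (preorbit g x)) /\
  robustly_transitive f.
Proof.
case: n hn N hN f hvol hdense U0 hU0 hexp a hframe hdiam hdelta0_int U1 hU1 hU01
  harc hback => // n _.
case: r hr => // r _ N hN f hvol hdense U0 _ hexp a hframe hdiam hdelta0_int U1 _
  hU01 harc _.
have [|e e0 he] :=
  robust_preorbit_density hN hvol hdense hexp hframe hdiam hdelta0 hdelta0_int.
  move=> gamma c h1 h2 h3 h4; have [y yg hy] := harc gamma c h1 h2 h3 h4.
  by exists y => // k k1 /(@subset_closure _ U0)/hU01; exact: hy.
split; apply/nbhs_ballP; exists e => // g /he[G [Gg cG H]].
  move=> x; have [x' <-] := torus_proj_surj x.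
  by apply: lift_dense_preorbit Gg _ => q s s0; exact: H.
exact: lift_transitive Gg cG H.
Qed.
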